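(* Every set of EFD-sentences in the language $\{+,-,0,\vee,\wedge\}$ either has only trivial models in $\mathcal{G}$ or is equivalent over $\mathcal{G}$ to $\Sigma_S:=\{\delta_p:p\in S\}$ for some set $S$ of prime numbers. Furthermore, the map $S\mapsto\Sigma_S$ is one-to-one (distinct sets of primes give sets of sentences that are not equivalent over $\mathcal{G}$), and thus the lattice of AE-subclasses of $\mathcal{G}$, ordered by inclusion, is isomorphic with $\mathbf{1}\oplus\mathbf{2}^\omega$.
   Context: $\mathcal{G}$ is the variety of Abelian $\ell$-groups in the language $\{+,-,0,\vee,\wedge\}$: $(A,+,-,0)$ an Abelian group, $(A,\vee,\wedge)$ a lattice, and $a+(b\vee c)=(a+b)\vee(a+c)$. An EFD-sentence is a sentence of the form $\forall x_1\dots x_n\exists! z_1\dots z_m\bigwedge_{i=1}^k s_i(\bar x,\bar z)=t_i(\bar x,\bar z)$ with terms $s_i,t_i$, $n\ge0$, $m\ge1$. For a positive integer $k$, $\delta_k:=\forall x\exists! z\;kz=x$. Two sets of sentences are equivalent over a class $\mathcal{K}$ if they have the same models in $\mathcal{K}$. An AE-subclass of $\mathcal{G}$ is a class of the form $\mathcal{G}\cap\mathrm{Mod}(\Sigma)$ for a set $\Sigma$ of EFD-sentences. $\mathbf{2}^\omega$ denotes the lattice of subsets of a countably infinite set, $\mathbf 1$ the one-element lattice, and $\oplus$ ordinal sum (the first summand placed below the second). *)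

(* Defs.v *)
From HB Require Import structures.
From mathcomp Require Import all_boot all_order.
From mathcomp Require Import boolp classical_sets.

Set Implicit Arguments.
Unset Strict Implicit.
Unset Printing Implicit Defensive.
Import Order.TTheory.
Local Open Scope classical_set_scope.

(* Abelian l-groups, as algebras in the language {+, -, 0, join, meet}. The
   carrier is a bare [Type] rather than a zmodType or a latticeType because of
   universes: lgroupType must itself be an admissible argument of [set], which
   the bundled MathComp structures are not. *)
Record lgroupType := LGroup {
  lgroup_sort :> Type;
  lg_add : lgroup_sort -> lgroup_sort -> lgroup_sort;
  lg_opp : lgroup_sort -> lgroup_sort;
  lg_zero : lgroup_sort;
  lg_join : lgroup_sort -> lgroup_sort -> lgroup_sort;
  lg_meet : lgroup_sort -> lgroup_sort -> lgroup_sort;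
  lg_addA : associative lg_add;
  lg_addC : commutative lg_add;
  lg_add0 : left_id lg_zero lg_add;
  lg_addN : left_inverse lg_zero lg_opp lg_add;
  lg_joinC : commutative lg_join;
  lg_meetC : commutative lg_meet;
  lg_joinA : associative lg_join;
  lg_meetA : associative lg_meet;
  lg_joinKI : forall b a, lg_meet a (lg_join a b) = a;
  lg_meetKU : forall b a, lg_join a (lg_meet a b) = a;
  lg_add_joinr : right_distributive lg_add lg_join
}.

Arguments lg_zero : clear implicits.

(* Terms in the language {+, -, 0, join, meet}, with unary -. *)
Inductive term (V : Type) : Type :=
| TVar of V
| TZero
| TOpp of term V
| TAdd of term V & term V
| TJoin of term V & term V
| TMeet of term V & term V.

Arguments TZero {V}.

Fixpoint eval (A : lgroupType) (V : Type) (v : V -> A) (t : term V) : A :=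
  match t with
  | TVar i => v i
  | TZero => lg_zero A
  | TOpp t1 => lg_opp (eval v t1)
  | TAdd t1 t2 => lg_add (eval v t1) (eval v t2)
  | TJoin t1 t2 => lg_join (eval v t1) (eval v t2)
  | TMeet t1 t2 => lg_meet (eval v t1) (eval v t2)
  end.

(* The sentence  forall x_1 .. x_n exists! z_1 .. z_m,
   /\_(i < k) s_i(x, z) = t_i(x, z);  in the terms, [inl i] stands for x_i
   and [inr j] for z_j. *)
Record efd := EFD {
  efd_n : nat;
  efd_m : nat;
  efd_k : nat;
  efd_m_gt0 : (0 < efd_m)%N;
  efd_lhs : 'I_efd_k -> term ('I_efd_n + 'I_efd_m);
  efd_rhs : 'I_efd_k -> term ('I_efd_n + 'I_efd_m)
}.

Arguments efd_lhs : clear implicits.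
Arguments efd_rhs : clear implicits.

Definition assign (A : Type) (n m : nat) (x : n.-tuple A) (z : m.-tuple A)
    (v : 'I_n + 'I_m) : A :=
  match v with inl i => tnth x i | inr j => tnth z j end.

Definition sat (A : lgroupType) (phi : efd) : Prop :=
  forall x : (efd_n phi).-tuple A, exists! z : (efd_m phi).-tuple A,
  forall i : 'I_(efd_k phi),
    eval (assign x z) (efd_lhs phi i) = eval (assign x z) (efd_rhs phi i).

Definition Mod (Sigma : set efd) : set lgroupType :=
  [set A | forall phi, Sigma phi -> sat A phi].

Definition equiv_over_lgroups (Sigma1 Sigma2 : set efd) : Prop :=
  forall A : lgroupType, Mod Sigma1 A <-> Mod Sigma2 A.

Definition trivial_lgroup (A : lgroupType) : Prop := forall a b : A, a = b.

Definition tmuln (V : Type) (k : nat) (t : term V) : term V :=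
  iterop k (@TAdd V) t TZero.

Definition delta (k : nat) : efd :=
  @EFD 1 1 1 (ltn0Sn 0)
    (fun=> tmuln k (TVar (inr ord0)))
    (fun=> TVar (inl ord0)).

Definition lg_muln (A : lgroupType) (k : nat) (a : A) : A :=
  iterop k (@lg_add A) a (lg_zero A).

Lemma eval_tmuln (A : lgroupType) (V : Type) (v : V -> A) k t :
  eval v (tmuln k t) = lg_muln k (eval v t).
Proof.
case: k => [|k] //; elim: k => [|k IHk] //.
exact: (congr1 (lg_add _) IHk).
Qed.

Lemma sat_delta (A : lgroupType) k :
  sat A (delta k) <-> forall x : A, exists! z : A, lg_muln k z = x.
Proof.
have E (x z : 1.-tuple A) :
    (forall i, eval (assign x z) (efd_lhs (delta k) i) =
               eval (assign x z) (efd_rhs (delta k) i)) <->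
    lg_muln k (tnth z ord0) = tnth x ord0.
  by split=> [/(_ ord0)|e i]; rewrite /= eval_tmuln.
split=> [H x|H x].
  have [z [/E ez uz]] := H [tuple x].
  exists (tnth z ord0); split=> // y ey.
  have -> : z = [tuple y] by apply: uz; apply/E.
  by [].
have [z [ez uz]] := H (tnth x ord0).
exists [tuple z]; split; first exact/E.
move=> y /E /uz ->; apply: eq_from_tnth => i.
by rewrite (ord1 i).
Qed.

Definition Sigma_ (S : set nat) : set efd := delta @` S.

(* AE-subclasses, with the inclusion order inherited from [set lgroupType];
   joins are closures of unions under the Galois connection (Mod, Th). *)
Definition aeSubclass := set_type (range Mod).

HB.instance Definition _ := SubChoice.on aeSubclass.
HB.instance Definition _ :=
  [SubChoice_isSubPOrder of aeSubclass by <: with set_display].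

Section AELattice.

Definition Th (K : set lgroupType) : set efd :=
  [set phi | forall A, K A -> sat A phi].

Definition ae_of (Sigma : set efd) : aeSubclass :=
  exist _ (Mod Sigma) (mem_set (imageT Mod Sigma)).

Definition ae_meet (K L : aeSubclass) : aeSubclass :=
  ae_of (Th (val K) `|` Th (val L)).
Definition ae_join (K L : aeSubclass) : aeSubclass :=
  ae_of (Th (val K `|` val L)).

Lemma ae_leE (K L : aeSubclass) : (K <= L)%O = (val K `<=` val L) :> Prop.
Proof. by rewrite -subsetEset. Qed.

Lemma ae_ModTh (K : aeSubclass) : Mod (Th (val K)) = val K.
Proof.
have [Sigma _ <-] := set_mem (valP K).
apply/seteqP; split=> [A H phi Sphi|A H phi]; last exact.
by apply: H => B; apply.
Qed.

Lemma ae_meetP (K L M : aeSubclass) :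
  (K <= ae_meet L M)%O = (K <= L)%O && (K <= M)%O.
Proof.
apply/idP/andP; rewrite !ae_leE.
  move=> H; rewrite -(ae_ModTh L) -(ae_ModTh M).
  by split=> A /H HA phi phiT; apply: HA; [left | right].
by move=> [HL HM] A KA phi [] /=; apply; [apply: HL | apply: HM].
Qed.

Lemma ae_joinP (K L M : aeSubclass) :
  (ae_join K L <= M)%O = (K <= M)%O && (L <= M)%O.
Proof.
apply/idP/andP; rewrite !ae_leE.
  by move=> H; split=> A KA; apply: H => phi; apply; [left | right].
move=> [HK HL] A HA; rewrite -ae_ModTh => phi phiM.
by apply: HA => B [/HK|/HL]; apply: phiM.
Qed.

HB.instance Definition _ := Order.POrder_MeetJoin_isLattice.Build
  set_display aeSubclass ae_meetP ae_joinP.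

End AELattice.

(* Ordinal sum: the left summand lies below the right one. *)
Definition osum (T1 T2 : Type) : Type := (T1 + T2)%type.

Fact osum_display : Order.disp_t. Proof. by []. Qed.

Section OrdinalSum.
Context (d1 d2 : Order.disp_t).

Section POrder.
Variables (T1 : porderType d1) (T2 : porderType d2).

Definition osum_le (u v : osum T1 T2) : bool :=
  match u, v with
  | inl a, inl b => (a <= b)%O
  | inr a, inr b => (a <= b)%O
  | inl _, inr _ => true
  | inr _, inl _ => false
  end.

Fact osum_le_refl : reflexive osum_le.
Proof. by case=> a /=. Qed.

Fact osum_le_anti : antisymmetric osum_le.
Proof. by move=> [a|a] [b|b] //= /le_anti ->. Qed.

Fact osum_le_trans : transitive osum_le.
Proof. by move=> [a|a] [b|b] [c|c] //=; apply: le_trans. Qed.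

HB.instance Definition _ := Choice.on (osum T1 T2).
HB.instance Definition _ := Order.Le_isPOrder.Build osum_display (osum T1 T2)
  osum_le_refl osum_le_anti osum_le_trans.
End POrder.

Section Lattice.
Variables (T1 : latticeType d1) (T2 : latticeType d2).

Definition osum_meet (u v : osum T1 T2) : osum T1 T2 :=
  match u, v with
  | inl a, inl b => inl (Order.meet a b)
  | inr a, inr b => inr (Order.meet a b)
  | inl a, inr _ => inl a
  | inr _, inl b => inl b
  end.

Definition osum_join (u v : osum T1 T2) : osum T1 T2 :=
  match u, v with
  | inl a, inl b => inl (Order.join a b)
  | inr a, inr b => inr (Order.join a b)
  | inl _, inr b => inr b
  | inr a, inl _ => inr a
  end.

Fact osum_meetP (u v w : osum T1 T2) :
  (u <= osum_meet v w)%O = (u <= v)%O && (u <= w)%O.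
Proof.
by case: u v w => [a|a] [b|b] [c|c]; rewrite /Order.le /= ?lexI ?andbT ?andbF.
Qed.

Fact osum_joinP (u v w : osum T1 T2) :
  (osum_join u v <= w)%O = (u <= w)%O && (v <= w)%O.
Proof.
by case: u v w => [a|a] [b|b] [c|c];
  rewrite /Order.le /= ?leUx ?andbT ?andbF.
Qed.

HB.instance Definition _ := Order.POrder_MeetJoin_isLattice.Build
  osum_display (osum T1 T2) osum_meetP osum_joinP.
End Lattice.

End OrdinalSum.

Definition lattice_iso (d1 d2 : Order.disp_t)
    (L1 : latticeType d1) (L2 : latticeType d2) : Prop :=
  exists f : L1 -> L2, bijective f /\ {mono f : x y / (x <= y)%O}.

(* Main.v *)
(* Quasi-identities valid in the rationals Q hold in every abelian l-group: a
   term is a difference of two joins of integral linear forms, and Farkas' lemma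
   turns an inequality valid in Q into a convex combination that makes sense in
   any abelian l-group. Hence, if an EFD-sentence phi has a nontrivial model, its
   unique solution z = f(x) exists over Q. There f is continuous, positively
   homogeneous and piecewise linear; the coefficients of the pieces on
   full-dimensional cells are differences of values of f at integer points, and
   every model of phi is divisible by the denominators of those values. Writing
   f as a maximum of minima of such pieces gives terms t_j and integers d_j, by
   which all models of phi are divisible, with d_j z_j = t_j(x). By transfer
   back from Q, phi holds as soon as division by every d_j is possible, i.e. phi
   is equivalent to delta_d for d the product of the d_j. The localizations of Z
   at primes separate the sets of primes. *)
From HB Require Import structures.
Require Import Defs.
From mathcomp Require Import all_boot all_order all_algebra.
From mathcomp Require Import boolp classical_sets functions cardinality.
From mathcomp Require Import ring lra.

Set Implicit Arguments.
Unset Strict Implicit.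
Unset Printing Implicit Defensive.
Import Order.TTheory GRing.Theory Num.Theory.
Local Open Scope ring_scope.

(** * Abelian l-groups *)

(** Why Q decides: the multiples of an element [b > 0] of a nontrivial model form a copy of Z, so
    two rational solutions, cleared of denominators, would give two solutions in the model.
    Existence cannot be carried over in this way, since solutions in the model may leave the copy of
    Z; instead, unsolvability over Q along a ray is itself a quasi-identity, with conclusion w <= 0,
    and [b] refutes it. Quasi-identities transfer because P <= 0 -> w <= 0 over Q can be sharpened
    to an unconditional inequality w <= N (P \/ 0). Continuity of f is never stated topologically:
    it appears as a subdivision of every segment into finitely many closed intervals with common
    endpoints and one linear formula on each. A piece met only on a lower-dimensional set has
    uncontrolled coefficients, so the max-min formula must restrict itself to pieces with controlled
    entries, and regular points serve to show that there are enough of them. *)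

HB.instance Definition _ (A : lgroupType) := gen_eqMixin (lgroup_sort A).
HB.instance Definition _ (A : lgroupType) := gen_choiceMixin (lgroup_sort A).
HB.instance Definition _ (A : lgroupType) :=
  GRing.isZmodule.Build (lgroup_sort A)
    (@lg_addA A) (@lg_addC A) (@lg_add0 A) (@lg_addN A).

Section LGroupTheory.
Variable A : lgroupType.
Implicit Types a b c : A.

Definition lg_le a b : Prop := lg_join a b = b.

Lemma lg_joinDr a b c : a + lg_join b c = lg_join (a + b) (a + c).
Proof. exact: lg_add_joinr. Qed.

Lemma lg_joinDl a b c : lg_join b c + a = lg_join (b + a) (c + a).
Proof. by rewrite addrC lg_joinDr !(addrC a). Qed.

Lemma lg_le_refl a : lg_le a a.
Proof. by rewrite /lg_le -{2}(lg_joinKI a a) lg_meetKU. Qed.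

Lemma lg_le_trans b a c : lg_le a b -> lg_le b c -> lg_le a c.
Proof. by rewrite /lg_le => ab <-; rewrite lg_joinA ab. Qed.

Lemma lg_le_anti a b : lg_le a b -> lg_le b a -> a = b.
Proof. by rewrite /lg_le => ab ba; rewrite -ba lg_joinC. Qed.

Lemma lg_leUl a b : lg_le a (lg_join a b).
Proof. by rewrite /lg_le lg_joinA lg_le_refl. Qed.

Lemma lg_leUr a b : lg_le b (lg_join a b).
Proof. by rewrite lg_joinC; apply: lg_leUl. Qed.

Lemma lg_leUx a b c : lg_le (lg_join a b) c <-> lg_le a c /\ lg_le b c.
Proof.
split=> [abc|[ac bc]].
  by split; apply: lg_le_trans abc; [apply: lg_leUl | apply: lg_leUr].
by rewrite /lg_le -lg_joinA bc.
Qed.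

Lemma lg_leD2l c a b : lg_le (c + a) (c + b) <-> lg_le a b.
Proof. by rewrite /lg_le -lg_joinDr; split=> [/addrI//|->]. Qed.

Lemma lg_leD2r c a b : lg_le (a + c) (b + c) <-> lg_le a b.
Proof. by rewrite !(addrC _ c) lg_leD2l. Qed.

Lemma lg_leD a b c d : lg_le a b -> lg_le c d -> lg_le (a + c) (b + d).
Proof.
by move=> ab cd; apply: (@lg_le_trans (b + c)); [apply/lg_leD2r | apply/lg_leD2l].
Qed.

Lemma lg_subr_le0 a b : lg_le (a - b) 0 <-> lg_le a b.
Proof. by rewrite -(lg_leD2r b) subrK add0r. Qed.

Lemma lg_le_subr a b c : lg_le a (c - b) <-> lg_le (a + b) c.
Proof. by rewrite -(lg_leD2r b) subrK. Qed.

Lemma lg_le_opp a b : lg_le (- a) (- b) <-> lg_le b a.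
Proof. by rewrite -(lg_leD2r (a + b)) addKr [a + b]addrC addKr. Qed.

Lemma lg_leMn n a b : lg_le a b -> lg_le (a *+ n) (b *+ n).
Proof.
by move=> ab; elim: n => [|n IH]; [apply: lg_le_refl | rewrite !mulrS; apply: lg_leD].
Qed.

Lemma lg_le_sum (I : Type) (r : seq I) (F G : I -> A) :
  (forall i, lg_le (F i) (G i)) -> lg_le (\sum_(i <- r) F i) (\sum_(i <- r) G i).
Proof.
move=> FG; elim: r => [|i r IH]; first by rewrite !big_nil; apply: lg_le_refl.
by rewrite !big_cons; apply: lg_leD.
Qed.

(** The source of torsion-freeness: writing a^+ for the join of a and 0, if (n+1) a <= 0 then the
    right side collapses to n a^+, and cancelling leaves a^+ = 0. *)
Lemma lg_pospartMn n a :
  lg_join a 0 *+ n.+1 = lg_join (a *+ n.+1) (lg_join a 0 *+ n).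
Proof.
elim: n => [|n IH]; first by [].
rewrite mulrSr lg_joinDr addr0 {1}IH lg_joinDl -mulrSr -lg_joinA.
suff -> : lg_le (lg_join a 0 *+ n + a) (lg_join a 0 *+ n.+1) by [].
by rewrite mulrSr; apply/lg_leD2l/lg_leUl.
Qed.

Lemma lg_leMn_inv n a b : lg_le (a *+ n.+1) (b *+ n.+1) -> lg_le a b.
Proof.
rewrite -lg_subr_le0 -mulrnBl -(lg_subr_le0 a b); move: (a - b) => c cn.
have ge0 k : lg_le 0 (lg_join c 0 *+ k).
  by have := lg_leMn k (lg_leUr c 0); rewrite mul0rn.
have := lg_pospartMn n c; rewrite (lg_le_trans cn (ge0 n)) mulrS.
by move/(congr1 (fun x => x - lg_join c 0 *+ n)); rewrite addrK subrr.
Qed.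

Lemma lg_mulrn_inj n a b : a *+ n.+1 = b *+ n.+1 -> a = b.
Proof.
move=> ab; apply: lg_le_anti; apply: (@lg_leMn_inv n); rewrite ab;
  exact: lg_le_refl.
Qed.

(** The axioms distribute + over joins only; through this formula meets become joins reversed by
    negation. *)
Lemma lg_meetE a b : lg_meet a b = - lg_join (- a) (- b).
Proof.
have le_meet c d : lg_le c d <-> lg_meet c d = c.
  rewrite /lg_le; split=> [<-|<-]; first exact: lg_joinKI.
  by rewrite lg_joinC lg_meetC lg_meetKU.
have meetl c d : lg_le (lg_meet c d) c.
  by rewrite /lg_le lg_joinC lg_meetKU.
apply: lg_le_anti.
  rewrite -[X in lg_le X]opprK lg_le_opp lg_leUx !lg_le_opp.
  by split; [|rewrite lg_meetC]; apply: meetl.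
set c := - _.
have ca : lg_le c a by rewrite -lg_le_opp opprK; apply: lg_leUl.
have cb : lg_le c b by rewrite -lg_le_opp opprK; apply: lg_leUr.
by apply/le_meet; rewrite lg_meetA (iffLR (le_meet _ _) ca); apply/le_meet.
Qed.

Lemma lg_mulnE n a : lg_muln n a = a *+ n.
Proof. by []. Qed.

End LGroupTheory.

Fact rat_joinKI (b a : rat) : Num.min a (Num.max a b) = a.
Proof. by case: (leP a b) => ab; [apply/min_idPl | rewrite minxx]. Qed.

Fact rat_meetKU (b a : rat) : Num.max a (Num.min a b) = a.
Proof. by case: (leP a b) => ab; [rewrite maxxx | apply/max_idPl/ltW]. Qed.

Definition Qlg : lgroupType := @LGroup rat +%R -%R 0 Num.max Num.min
  (@addrA rat) (@addrC rat) (@add0r rat) (@addNr rat)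
  (@maxC _ rat) (@minC _ rat) (@maxA _ rat) (@minA _ rat)
  rat_joinKI rat_meetKU (@addr_maxr rat).

Lemma lg_leQ (a b : rat) : @lg_le Qlg a b <-> a <= b.
Proof. by rewrite /lg_le /=; split=> [/max_idPr|/max_idPr]. Qed.

Lemma Qlg_mulrn (a : rat) n : (a : Qlg) *+ n = a *+ n.
Proof. by elim: n => [//|n IH]; rewrite !mulrS IH. Qed.

Lemma Qlg_mulrz (a : rat) (k : int) : (a : Qlg) *~ k = a *~ k.
Proof. by case: k => n; rewrite ?NegzE ?mulrNz -?pmulrn Qlg_mulrn. Qed.

(** * Farkas' lemma *)

(* Bartl's coordinate-free induction on the number of forms. *)
Lemma farkas (W : lmodType rat) (k : nat) (al : nat -> W -> rat) (be : W -> rat) :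
  (forall i (a : rat) x y, al i (a *: x + y) = a * al i x + al i y) ->
  (forall (a : rat) x y, be (a *: x + y) = a * be x + be y) ->
  (forall x, (forall i, (i < k)%N -> al i x <= 0) -> be x <= 0) ->
  exists2 la : nat -> rat, (forall i, 0 <= la i) &
    forall x, be x = \sum_(i < k) la i * al i x.
Proof.
elim: k al be => [|k IH] al be lal lbe H.
  exists (fun=> 0) => // x; rewrite big_ord0.
  have bx : be x <= 0 by apply: H.
  have : be ((-1) *: x + 0) <= 0 by apply: H.
  have b0 : be 0 = 0 by have := lbe 1 0 0; rewrite scale1r addr0 mul1r; lra.
  rewrite lbe b0; lra.
have [H'|] := pselect (forall x, (forall i, (i < k)%N -> al i x <= 0) -> be x <= 0).
  have [la la0 lab] := IH al be lal lbe H'.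
  exists (fun i => if (i < k)%N then la i else 0) => [i|x]; first by case: ifP.
  rewrite big_ord_recr /= ltnn mul0r addr0 lab.
  by apply: eq_bigr => i _; rewrite ltn_ord.
move=> /existsNP[x0 /not_implyP[x0al /negP]]; rewrite -ltNge => x0be.
have a0 : 0 < al k x0.
  rewrite ltNge; apply/negP => ak; move: x0be; rewrite ltNge H // => i.
  by rewrite ltnS leq_eqVlt => /predU1P[->//|/x0al].
(* [P] projects along [x0] onto the kernel of the last form; there the other k forms alone force
   [be <= 0], so induction applies after composing with [P]. *)
pose P x := x - (al k x / al k x0) *: x0.
have lP (a : rat) x y : P (a *: x + y) = a *: P x + P y.
  rewrite /P lal scalerBr scalerA mulrDl scalerDl opprD addrACA.
  by rewrite mulrA.
have [||x Hx|la la0 lab] := IH (fun i x => al i (P x)) (be \o P).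
- by move=> i a x y; rewrite lP lal.
- by move=> a x y /=; rewrite lP lbe.
- apply: H => i; rewrite ltnS leq_eqVlt => /predU1P[->|/Hx//].
  rewrite /P addrC -scaleNr lal mulNr divfK ?gt_eqF //; lra.
have decomp i x : al i x = al i (P x) + (al k x / al k x0) * al i x0.
  by rewrite -{1}(subrK ((al k x / al k x0) *: x0) x) addrC lal addrC.
have decompb x : be x = be (P x) + (al k x / al k x0) * be x0.
  by rewrite -{1}(subrK ((al k x / al k x0) *: x0) x) addrC lbe addrC.
pose s := \sum_(i < k) la i * al i x0.
have s0 : s <= 0.
  by apply: sumr_le0 => i _; rewrite mulr_ge0_le0 // x0al.
(* The last coefficient is dictated by evaluation at [x0]; it is nonnegative because
   [s <= 0 < be x0]. *)
exists (fun i => if (i < k)%N then la i else (be x0 - s) / al k x0) => [i|x].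
  by case: ifP => // _; rewrite divr_ge0 ?ltW // subr_gt0 (le_lt_trans s0).
rewrite big_ord_recr /= ltnn decompb.
have -> : be (P x) = \sum_(i < k) la i * al i (P x) by exact: lab.
have -> : \sum_(i < k) (if (i < k)%N then la i else (be x0 - s) / al k x0) * al i x
  = \sum_(i < k) la i * al i (P x) + (al k x / al k x0) * s.
  rewrite mulr_sumr -big_split; apply: eq_bigr => i _ /=.
  by rewrite ltn_ord {1}decomp; ring.
by ring.
Qed.

(** * Integral linear forms with values in an abelian group *)

Section LinearForms.
Variable V : finType.

Definition form := {ffun V -> int}.
Implicit Types c d : form.

Definition lin (M : zmodType) (c : form) (v : V -> M) : M := \sum_i v i *~ c i.

Lemma linD (M : zmodType) c d (v : V -> M) : lin (c + d) v = lin c v + lin d v.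
Proof. by rewrite -big_split; apply: eq_bigr => i _; rewrite ffunE mulrzDr. Qed.

Lemma lin0 (M : zmodType) (v : V -> M) : lin 0 v = 0.
Proof. by rewrite /lin big1 // => i _; rewrite ffunE mulr0z. Qed.

Lemma linN (M : zmodType) c (v : V -> M) : lin (- c) v = - lin c v.
Proof. by apply/eqP; rewrite -addr_eq0 -linD addNr lin0. Qed.

Lemma linMn (M : zmodType) c (v : V -> M) n : lin (c *+ n) v = lin c v *+ n.
Proof. by elim: n => [|n IH]; rewrite ?lin0 // !mulrS linD IH. Qed.

Lemma lin_sum (M : zmodType) (I : Type) (r : seq I) (F : I -> form) (v : V -> M) :
  lin (\sum_(i <- r) F i) v = \sum_(i <- r) lin (F i) v.
Proof. by apply: (big_morph (fun c => lin c v)) => [c d|]; rewrite ?linD ?lin0. Qed.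

Definition var_form (i : V) : form := [ffun j => (i == j)%:Z].

Lemma lin_var (M : zmodType) i (v : V -> M) : lin (var_form i) v = v i.
Proof.
rewrite /lin (bigD1 i) //= ffunE eqxx big1 ?addr0 // => j ji.
by rewrite ffunE eq_sym (negPf ji).
Qed.

Lemma linQ c (x : V -> rat) :
  @lin (lgroup_sort Qlg) c x = lin c x.
Proof.
rewrite /lin; apply: (big_ind2 (fun (a : Qlg) (b : rat) => a = b)) => //.
by move=> a b a' b' -> ->.
Qed.

Lemma lin_ratE c (x : V -> rat) : lin c x = \sum_i (c i)%:~R * x i.
Proof. by apply: eq_bigr => i _; rewrite -mulrzr mulrC. Qed.

Lemma lin_rat_linear c a (x y : V -> rat) :
  lin c (fun i => a * x i + y i) = a * lin c x + lin c y.
Proof.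
rewrite !lin_ratE mulr_sumr -big_split; apply: eq_bigr => i _ /=; ring.
Qed.

Lemma rat_common_denom (I : finType) (la : I -> rat) : exists2 N : nat, (0 < N)%N &
  exists m : I -> int, forall i, la i *+ N = (m i)%:~R.
Proof.
exists (\prod_i `|denq (la i)|)%N.
  by rewrite prodn_gt0 // => i; rewrite absz_gt0 denq_neq0.
exists (fun i => numq (la i) *+ \prod_(j | j != i) `|denq (la j)|)%N => i.
rewrite (bigD1 i) //= mulrnA -[la i *+ _]mulr_natr natr_absz gtr0_norm ?denq_gt0 //.
by rewrite -numqE rmorphMn.
Qed.

(* By Farkas, [c] is a convex combination of the elements of [q]. *)
Lemma lin_le_max c (q : seq form) :
  (forall x : V -> rat, exists2 d, d \in q & lin c x <= lin d x) ->
  forall (A : lgroupType) (v : V -> A) (y : A),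
    (forall d, d \in q -> lg_le (lin d v) y) -> lg_le (lin c v) y.
Proof.
move=> H A v y Hy.
(* The extra coordinate t homogenizes the maximum: if q_i(x) - c(x) + t <= 0 for all i, then t <= 0.
   Comparing the coefficients of t and of x gives weights of sum 1 and the convex combination. *)
pose W : lmodType rat := {ffun option V -> rat^o}; pose k := size q.
pose al i (x : W) := lin (nth 0 q i - c) (fun j => x (Some j)) + x None.
pose be (x : W) := x None.
have [||x Hx|la la0 lab] := @farkas W k al be.
- move=> i a x y'; rewrite /al.
  have -> : (fun j => (a *: x + y') (Some j)) =
            (fun j => a * x (Some j) + y' (Some j)).
    by apply/funext => j; rewrite !ffunE.
  by rewrite lin_rat_linear !ffunE -[a *: _]/(a * _); ring.
- by move=> a x y'; rewrite /be !ffunE.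
- have [d dq cd] := H (fun j => x (Some j)).
  have := Hx (index d q); rewrite index_mem dq /al nth_index // => /(_ isT).
  by rewrite linD linN /be; lra.
have sum1 : \sum_(i < k) la i = 1.
  have := lab [ffun j => (j == None)%:R]; rewrite /be ffunE eqxx => e1.
  rewrite -[RHS]/(true%:R) e1.
  apply: eq_bigr => i _; rewrite /al ffunE eqxx.
  rewrite lin_ratE big1 ?add0r ?mulr1 // => j _; by rewrite [X in _ * X]ffunE /= mulr0.
have conv (j : V) : (c j)%:~R = \sum_(i < k) la i * (nth 0 q i j)%:~R.
  have := lab [ffun l => (l == Some j)%:R]; rewrite /be ffunE /= => e0.
  have : \sum_(i < k) la i * ((nth 0 q i j)%:~R - (c j)%:~R) = 0.
    rewrite -[RHS]/(false%:R) e0; apply: eq_bigr => i _.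
    rewrite /al [X in _ = _ * (_ + X)]ffunE /= addr0; congr (_ * _).
    rewrite lin_ratE (bigD1 j) //= !ffunE eqxx mulr1 big1 ?addr0.
      by rewrite rmorphB.
    by move=> l lj; rewrite [X in _ * X]ffunE (inj_eq Some_inj) (negPf lj) mulr0.
  under [X in X = _ -> _]eq_bigr do rewrite mulrBr.
  by rewrite sumrB -mulr_suml sum1 mul1r => /eqP; rewrite subr_eq0 => /eqP->.
(* Scaled by N, the weights become natural numbers [m i] of sum N; the inequality N c(v) <= N y then
   makes sense in A, and torsion-freeness removes N. *)
have [N N0 [z Hz]] := rat_common_denom (fun i : 'I_k => la i).
pose m (i : 'I_k) := `|z i|%N.
have Hm (i : 'I_k) : la i *+ N = (m i)%:R.
  by rewrite Hz natr_absz ger0_norm // -(ler0z rat) -Hz mulrn_wge0.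
have summ : (\sum_(i < k) m i = N)%N.
  apply/eqP; rewrite -(eqr_nat rat) natr_sum; apply/eqP.
  transitivity (\sum_(i < k) la i *+ N); last by rewrite sumrMnl sum1.
  by apply: eq_bigr => i _; rewrite Hm.
have convz : c *+ N = \sum_(i < k) nth 0 q i *+ m i.
  apply/ffunP => j; apply: (@intr_inj rat).
  rewrite ffunMnE rmorphMn /= conv -sumrMnl sum_ffunE rmorph_sum.
  apply: eq_bigr => i _; rewrite ffunMnE rmorphMn /= -mulrnAl Hm //.
  by rewrite mulr_natl.
case: N N0 summ convz {Hz Hm} => // N _ summ convz.
apply: (@lg_leMn_inv _ N); rewrite -linMn convz lin_sum -summ -sumrMnr.
apply: lg_le_sum => i; rewrite linMn; apply: lg_leMn.
exact/Hy/mem_nth.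
Qed.


End LinearForms.

(** * Transfer of quasi-identities from the rationals *)

Lemma strict_bound (s : seq rat) (b : rat) :
  (forall a, a \in s -> a < b) -> exists2 y, y < b & forall a, a \in s -> a <= y.
Proof.
elim: s => [_|a s IH H]; first by exists (b - 1) => //; rewrite ltrBlDr ltrDl.
have [y yb Hy] : exists2 y, y < b & forall a, a \in s -> a <= y.
  by apply: IH => c cs; apply: H; rewrite inE cs orbT.
exists (Num.max a y); first by rewrite gt_max yb H // mem_head.
by move=> c; rewrite inE le_max => /predU1P[->|/Hy->]; rewrite ?lexx ?orbT.
Qed.

Lemma finite_bound (T : eqType) (s : seq T) (P : T -> nat -> Prop) :
  (forall t, t \in s -> exists N0, forall N, (N0 <= N)%N -> P t N) ->
  exists N0, forall N, (N0 <= N)%N -> forall t, t \in s -> P t N.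
Proof.
elim: s => [_|t s IH H]; first by exists 0%N.
have [N1 H1] := H t (mem_head _ _).
have [N2 H2] : exists N0, forall N, (N0 <= N)%N -> forall t, t \in s -> P t N.
  by apply: IH => u us; apply: H; rewrite inE us orbT.
exists (maxn N1 N2) => N; rewrite geq_max => /andP[N1N N2N] u.
by rewrite inE => /predU1P[->|us]; [apply: H1 | apply: H2].
Qed.

Section Transfer.
Variable V : finType.
Implicit Types (cs ds : seq (form V)) (t : term V).

(** A universal property instead of an iterated join, which would need a bottom element to start
    from. *)
Definition is_sup (A : lgroupType) (v : V -> A) cs (s : A) : Prop :=
  forall y, lg_le s y <-> forall c, c \in cs -> lg_le (lin c v) y.

Lemma is_sup1 (A : lgroupType) (v : V -> A) c : is_sup v [:: c] (lin c v).
Proof.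
move=> y; split=> [cy d|]; first by rewrite inE => /eqP->.
by apply; rewrite mem_head.
Qed.

Lemma is_supU (A : lgroupType) (v : V -> A) cs ds s r :
  is_sup v cs s -> is_sup v ds r -> is_sup v (cs ++ ds) (lg_join s r).
Proof.
move=> ss sr y; rewrite lg_leUx ss sr; split=> [[H1 H2] c|H].
  by rewrite mem_cat => /orP[/H1|/H2].
by split=> c cc; apply: H; rewrite mem_cat cc ?orbT.
Qed.

Lemma is_supD (A : lgroupType) (v : V -> A) cs ds s r :
  is_sup v cs s -> is_sup v ds r ->
  is_sup v [seq c + d | c <- cs, d <- ds] (s + r).
Proof.
move=> ss sr y; split=> [H _ /allpairsP[[c d] /= [cc dd ->]]|H].
  rewrite linD; apply: lg_le_trans H; apply: lg_leD.
    exact: (iffLR (ss s) (lg_le_refl s)).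
  exact: (iffLR (sr r) (lg_le_refl r)).
apply/lg_le_subr/(iffRL (ss _)) => c cc; rewrite lg_le_subr addrC.
apply/lg_le_subr/(iffRL (sr _)) => d dd; rewrite lg_le_subr addrC -linD.
by apply/H/allpairsP; exists (c, d).
Qed.

(** A strict upper bound of finitely many rationals can be lowered, so the supremum is attained; in
    particular the empty family has none. *)
Lemma is_supQ (x : V -> rat) cs (s : rat) : @is_sup Qlg x cs s ->
  (forall c, c \in cs -> lin c x <= s) /\ exists2 c, c \in cs & s = lin c x.
Proof.
move=> ss; have ub c : c \in cs -> lin c x <= s.
  move=> cc; rewrite -linQ; apply/lg_leQ.
  exact: (iffLR (ss s) (lg_le_refl _)).
split=> //; apply: contrapT => H.
have [|y ys Hy] := @strict_bound [seq lin c x | c <- cs] s.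
  move=> _ /mapP[c cc ->]; rewrite lt_neqAle ub // andbT.
  by apply/eqP => e; apply: H; exists c.
have : s <= y.
  apply/lg_leQ/(iffRL (ss _)) => c cc; apply/lg_leQ; rewrite linQ; apply: Hy.
  exact: map_f.
by rewrite leNgt ys.
Qed.

Definition evalQ (x : V -> rat) t : rat := @eval Qlg V x t.

(** The lists depend on the term alone, which makes Q comparable with an arbitrary A. Joins are put
    over a common subtrahend, (s - r) \/ (s' - r') = ((s + r') \/ (s' + r)) - (r + r'), and meets
    dually. *)
Lemma normal_form t : exists cs ds : seq (form V),
  forall (A : lgroupType) (v : V -> A), exists s r : A,
    [/\ is_sup v cs s, is_sup v ds r & eval v t = s - r].
Proof.
elim: t => [i||t [cs [ds H]]|t [cs [ds H]] t' [cs' [ds' H']]|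
  t [cs [ds H]] t' [cs' [ds' H']]|t [cs [ds H]] t' [cs' [ds' H']]].
- exists [:: var_form i], [:: 0] => A v; exists (lin (var_form i) v), (lin 0 v).
  by split; [exact: is_sup1|exact: is_sup1|rewrite lin0 lin_var subr0].
- exists [:: 0], [:: 0] => A v; exists (lin 0 v), (lin 0 v).
  by split; [exact: is_sup1|exact: is_sup1|rewrite subrr].
- exists ds, cs => A v; have [s [r [ss sr /= ->]]] := H A v; exists r, s.
  by split=> //; rewrite -[LHS]/(- (s - r)) opprB.
- exists [seq c + c' | c <- cs, c' <- cs'], [seq d + d' | d <- ds, d' <- ds'].
  move=> A v; have [s [r [ss sr /= ->]]] := H A v.
  have [s' [r' [ss' sr' ->]]] := H' A v; exists (s + s'), (r + r').
  split; [exact: is_supD|exact: is_supD|].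
  by rewrite -[LHS]/(s - r + (s' - r')) opprD addrACA.
- exists ([seq c + d | c <- cs, d <- ds'] ++ [seq c + d | c <- cs', d <- ds]),
    [seq d + d' | d <- ds, d' <- ds'].
  move=> A v; have [s [r [ss sr /= ->]]] := H A v.
  have [s' [r' [ss' sr' ->]]] := H' A v.
  exists (lg_join (s + r') (s' + r)), (r + r'); split.
  + by apply: is_supU; apply: is_supD.
  + exact: is_supD.
  + rewrite lg_joinDl opprD addrACA subrr addr0 [- r - r']addrC addrACA subrr.
    by rewrite addr0.
- exists [seq c + c' | c <- cs, c' <- cs'],
    ([seq d + c | d <- ds, c <- cs'] ++ [seq d + c | d <- ds', c <- cs]).
  move=> A v; have [s [r [ss sr /= ->]]] := H A v.
  have [s' [r' [ss' sr' ->]]] := H' A v.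
  exists (s + s'), (lg_join (r + s') (r' + s)); split.
  + exact: is_supD.
  + by apply: is_supU; apply: is_supD.
  + rewrite lg_meetE !opprB -[RHS]opprB; congr (- _).
    rewrite lg_joinDl opprD addrACA subrr addr0 [- s - s']addrC addrACA subrr.
    by rewrite addr0.
Qed.

Lemma evalQ_normal cs ds t :
  (forall (A : lgroupType) (v : V -> A), exists s r : A,
    [/\ is_sup v cs s, is_sup v ds r & eval v t = s - r]) ->
  forall x : V -> rat, exists c d,
    [/\ c \in cs, d \in ds, forall c', c' \in cs -> lin c' x <= lin c x,
        forall d', d' \in ds -> lin d' x <= lin d x &
        evalQ x t = lin c x - lin d x].
Proof.
move=> H x; have [s [r [/is_supQ[Hs [c cc es]] /is_supQ[Hr [d dd er]] e]]] := H Qlg x.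
by exists c, d; split=> //; rewrite -?es -?er.
Qed.

(** For t = s - r, nonpositivity over Q puts each form of s below the maximum of the forms of r,
    which is the hypothesis of [lin_le_max]. *)
Lemma transfer_le0 t : (forall x, evalQ x t <= 0) ->
  forall (A : lgroupType) (v : V -> A), lg_le (eval v t) 0.
Proof.
move=> H A v; have [cs [ds nf]] := normal_form t.
have [s [r [ss sr ->]]] := nf A v.
apply/lg_subr_le0/(iffRL (ss _)) => c cc; apply: (@lin_le_max _ c ds);
  last exact: (iffLR (sr r) (lg_le_refl r)).
move=> x; have [c' [d [cc' dd mc md e]]] := evalQ_normal nf x.
exists d => //; apply: le_trans (mc c cc) _.
by rewrite -subr_le0 -e.
Qed.

Lemma lin_ffun (c : form V) (x : V -> rat) : lin c [ffun i => x i] = lin c x.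
Proof. by apply: eq_bigr => i _; rewrite ffunE. Qed.

Lemma farkas_forms (e g : form V) (fs : seq (form V)) :
  (forall x : V -> rat, lin e x <= 0 -> (forall f, f \in fs -> lin f x <= 0) ->
     lin g x <= 0) ->
  exists2 N : rat, 0 <= N &
    forall x : V -> rat, (forall f, f \in fs -> lin f x <= 0) ->
      lin g x <= N * lin e x.
Proof.
move=> H; pose W : lmodType rat := {ffun V -> rat^o}.
have linW c a (x y : W) : lin c (a *: x + y : W) = a * lin c x + lin c y.
  rewrite -lin_rat_linear; congr lin; apply/funext => i; by rewrite !ffunE.
have [|||la la0 lab] := @farkas W (size fs).+1
    (fun i x => lin (nth 0 (e :: fs) i) x) (fun x => lin g x).
- by move=> i; apply: linW.
- exact: linW.
- move=> x Hx; apply: H => [|f ff]; first exact: (Hx 0%N).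
  by have := Hx (index f fs).+1; rewrite ltnS index_mem ff /= nth_index //; apply.
exists (la 0%N) => // x Hx; have := lab [ffun i => x i].
rewrite lin_ffun => ->; rewrite big_ord_recl /= lin_ffun gerDl.
apply: sumr_le0 => i _; rewrite lin_ffun mulr_ge0_le0 // Hx //.
by apply: mem_nth; rewrite add0n.
Qed.

Lemma evalQ_tmuln (x : V -> rat) k t : evalQ x (tmuln k t) = evalQ x t *+ k.
Proof. by rewrite /evalQ eval_tmuln lg_mulnE Qlg_mulrn. Qed.

Lemma eval_tmulnE (A : lgroupType) (v : V -> A) k t :
  eval v (tmuln k t) = eval v t *+ k.
Proof. by rewrite eval_tmuln lg_mulnE. Qed.

(** Fixing which forms attain the maxima in P \/ 0 and in the subtracted part of w cuts the space
    into finitely many polyhedral cones. On each of them P \/ 0 is linear and Farkas' lemma supplies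
    a multiplier; N bounds them all. *)
Lemma le0_multiple P w :
  (forall x : V -> rat, evalQ x P <= 0 -> evalQ x w <= 0) ->
  exists N : nat, forall x, evalQ x w <= evalQ x (tmuln N (TJoin P TZero)).
Proof.
move=> H; set T := TJoin P TZero.
have TE x : evalQ x T = Num.max (evalQ x P) 0 by [].
have T0 x : 0 <= evalQ x T by rewrite TE le_max lexx orbT.
have TP x : evalQ x T <= 0 -> evalQ x P <= 0.
  by rewrite TE ge_max => /andP[].
have [as_ [bs nfT]] := normal_form T; have [cs [ds nfw]] := normal_form w.
pose top (a : form V) (s : seq (form V)) (x : V -> rat) :=
  forall a', a' \in s -> lin a' x <= lin a x.
have [N HN] : exists N0, forall N, (N0 <= N)%N -> forall a, a \in as_ ->
    forall b, b \in bs -> forall c, c \in cs -> forall d, d \in ds ->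
    forall x : V -> rat, top a as_ x -> top b bs x -> top d ds x ->
      evalQ x T = lin a x - lin b x -> lin c x - lin d x <= evalQ x T *+ N.
  apply: finite_bound => a ain; apply: finite_bound => b bin.
  apply: finite_bound => c cin; apply: finite_bound => d din.
  pose fs := [seq a' - a | a' <- as_] ++ [seq b' - b | b' <- bs] ++
             [seq d' - d | d' <- ds].
  have fsP (x : V -> rat) : (forall f, f \in fs -> lin f x <= 0) <->
      [/\ top a as_ x, top b bs x & top d ds x].
    split=> [Hf|[ta tb td] f].
      split=> e ein; rewrite -subr_le0 -linN -linD; apply: Hf;
      rewrite !mem_cat; apply/or3P; [constructor 1|constructor 2|constructor 3];
      exact: map_f.
    by rewrite !mem_cat => /or3P[] /mapP[e ein ->];
      rewrite linD linN subr_le0; [apply: ta | apply: tb | apply: td].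
  have eT (x : V -> rat) : top a as_ x -> top b bs x ->
      evalQ x T = lin a x - lin b x.
    move=> ta tb; have [a' [b' [a'in b'in ta' tb' ->]]] := evalQ_normal nfT x.
    congr (_ - _); apply/le_anti; first by rewrite ta // ta'.
    by rewrite tb // tb'.
  (* [c] is any form of [cs]: since [d] is maximal on the cone, c - d lies below w there. *)
  have [x|N N0 HN] := @farkas_forms (a - b) (c - d) fs.
    rewrite linD linN => ab /fsP[ta tb td].
    have [c' [d' [c'in d'in tc' td' e]]] := evalQ_normal nfw x.
    have : evalQ x w <= 0 by apply/H/TP; rewrite eT.
    rewrite e linD linN; apply: le_trans; apply: lerB; first exact: tc'.
    exact: td.
  exists (Num.bound N) => k Nk x ta tb td _.
  have := HN x (iffRL (fsP x) (And3 ta tb td)).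
  rewrite !linD !linN -eT //; move/le_trans; apply.
  rewrite -mulr_natl ler_wpM2r // ltW // (lt_le_trans (archi_boundP N0)) //.
  by rewrite ler_nat.
exists N => x; rewrite evalQ_tmuln.
have [a [b [ain bin ta tb e]]] := evalQ_normal nfT x.
have [c [d [cin din tc td ->]]] := evalQ_normal nfw x.
exact: (HN N _ a ain b bin c cin d din).
Qed.

Theorem quasi_identity_le P w :
  (forall x : V -> rat, evalQ x P <= 0 -> evalQ x w <= 0) ->
  forall (A : lgroupType) (v : V -> A),
    lg_le (eval v P) 0 -> lg_le (eval v w) 0.
Proof.
move=> /le0_multiple[N HN] A v HP.
have := @transfer_le0 (TAdd w (TOpp (tmuln N (TJoin P TZero)))) _ A v.
rewrite [eval v _](_ : _ = eval v w - eval v (tmuln N (TJoin P TZero))) //.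
rewrite eval_tmulnE [eval v (TJoin _ _)]HP mul0rn subr0; apply=> x.
by rewrite -[evalQ x _]/(evalQ x w - evalQ x (tmuln N (TJoin P TZero))) subr_le0.
Qed.

(** The absolute value |s - t|: an equation becomes an inequality [<= 0], the shape in which
    hypotheses are transferred. *)
Definition tdist s t : term V := TJoin (TAdd s (TOpp t)) (TAdd t (TOpp s)).

Lemma eval_tdist_le0 (A : lgroupType) (v : V -> A) s t :
  lg_le (eval v (tdist s t)) 0 <-> eval v s = eval v t.
Proof.
rewrite [eval v _](_ : _ = lg_join (eval v s - eval v t) (eval v t - eval v s)) //.
rewrite lg_leUx !lg_subr_le0; split=> [[]|->]; first exact: lg_le_anti.
by split; apply: lg_le_refl.
Qed.

Corollary quasi_identity P s t :
  (forall x : V -> rat, evalQ x P <= 0 -> evalQ x s = evalQ x t) ->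
  forall (A : lgroupType) (v : V -> A), lg_le (eval v P) 0 -> eval v s = eval v t.
Proof.
move=> H A v HP; apply/eval_tdist_le0; apply: quasi_identity_le HP => x /H e.
by apply/lg_leQ/(@eval_tdist_le0 Qlg).
Qed.

End Transfer.

(** * EFD-sentences with a nontrivial model *)

Definition vpair (X Y A : Type) (x : X -> A) (z : Y -> A) (v : X + Y) : A :=
  match v with inl i => x i | inr j => z j end.

Lemma eval_ext (A : lgroupType) (V : Type) (v w : V -> A) t :
  v =1 w -> eval v t = eval w t.
Proof. by move=> /funext ->. Qed.

Fixpoint term_subst (V W : Type) (s : V -> term W) (t : term V) : term W :=
  match t with
  | TVar i => s i
  | TZero => TZero
  | TOpp t1 => TOpp (term_subst s t1)
  | TAdd t1 t2 => TAdd (term_subst s t1) (term_subst s t2)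
  | TJoin t1 t2 => TJoin (term_subst s t1) (term_subst s t2)
  | TMeet t1 t2 => TMeet (term_subst s t1) (term_subst s t2)
  end.

Lemma eval_term_subst (A : lgroupType) (V W : Type) (v : W -> A) (s : V -> term W) t :
  eval v (term_subst s t) = eval (fun i => eval v (s i)) t.
Proof. by elim: t => //= [t ->|t -> t' ->|t -> t' ->|t -> t' ->]. Qed.

Definition tmulz (V : Type) (k : int) (t : term V) : term V :=
  match k with Posz n => tmuln n t | Negz n => TOpp (tmuln n.+1 t) end.

Lemma eval_tmulz (A : lgroupType) (V : finType) (v : V -> A) k t :
  eval v (tmulz k t) = eval v t *~ k.
Proof.
case: k => n; rewrite /tmulz; first by rewrite eval_tmulnE.
by rewrite NegzE mulrNz -[LHS]/(- eval v (tmuln n.+1 t)) eval_tmulnE.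
Qed.

Lemma evalQ_tmulz (V : finType) (x : V -> rat) k t :
  evalQ x (tmulz k t) = evalQ x t *~ k.
Proof. by rewrite /evalQ eval_tmulz Qlg_mulrz. Qed.

Lemma evalQ_scale (V : finType) (x : V -> rat) (D : rat) t : 0 <= D ->
  evalQ (fun i => D * x i) t = D * evalQ x t.
Proof.
rewrite /evalQ => D0.
elim: t => [i||t IH|t IH t' IH'|t IH t' IH'|t IH t' IH'] //=.
- by rewrite mulr0.
- by rewrite IH -[RHS]/(D * - _) mulrN.
- by rewrite IH IH' -[RHS]/(D * (_ + _)) mulrDr.
- by rewrite IH IH' -maxr_pMr.
- by rewrite IH IH' -minr_pMr.
Qed.

(* Evaluation inside the copy of the integers spanned by [b]. *)
Lemma eval_multiples (V : finType) (A : lgroupType) (b : A) (v : V -> int) t :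
  lg_le 0 b -> exists k : int,
    evalQ (fun i => (v i)%:~R) t = k%:~R /\ eval (fun i => b *~ v i) t = b *~ k.
Proof.
move=> b0; have mono (k l : int) : k <= l -> lg_le (b *~ k) (b *~ l).
  move=> kl; rewrite -(subrK k l) mulrzDr -[X in lg_le X]add0r lg_leD2r.
  have : 0 <= l - k by rewrite subr_ge0.
  by case: (l - k) => // n _; have := lg_leMn n b0; rewrite mul0rn.
have joinE (k l : int) : lg_join (b *~ k) (b *~ l) = b *~ Num.max k l.
  case: (leP k l) => [/mono //|/ltW/mono lk]; by rewrite lg_joinC lk.
rewrite /evalQ.
elim: t => [i||t [k [e1 e2]]|t [k [e1 e2]] t' [k' [e1' e2']]
  |t [k [e1 e2]] t' [k' [e1' e2']]|t [k [e1 e2]] t' [k' [e1' e2']]].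
- by exists (v i).
- by exists 0.
- by exists (- k); rewrite !mulrNz /= e1 e2.
- by exists (k + k'); rewrite !mulrzDr /= e1 e2 e1' e2'.
- exists (Num.max k k'); rewrite -joinE /= e1 e2 e1' e2'; split=> //.
  by case: (leP k k') => kk; [apply/max_idPr | apply/max_idPl]; rewrite ler_int // ltW.
- exists (Num.min k k'); rewrite /= e1 e2 e1' e2' lg_meetE -!mulrNz joinE -mulrNz.
  split; last by rewrite oppr_max !opprK.
  by case: (leP k k') => kk; [apply/min_idPl | apply/min_idPr]; rewrite ler_int // ltW.
Qed.

Lemma pos_mulrz_eq0 (A : lgroupType) (b : A) (k : int) :
  b <> 0 -> b *~ k = 0 -> k = 0.
Proof.
move=> b0; suff H n : b *+ n.+1 <> 0.
  case: k => [[//|n]|n]; first by move/H.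
  by rewrite NegzE mulrNz => /eqP; rewrite oppr_eq0 => /eqP/H.
by rewrite -(mul0rn _ n.+1) => /lg_mulrn_inj.
Qed.

Lemma nontrivial_pos (A : lgroupType) : ~ trivial_lgroup A ->
  exists2 b : A, lg_le 0 b & b <> 0.
Proof.
move=> nt; apply: contrapT => H; apply: nt => a a'.
have H0 (c : A) : lg_le c 0.
  have [e|/eqP c0] := eqVneq (lg_join c 0) 0.
    by rewrite -[X in lg_le _ X]e; apply: lg_leUl.
  by case: H; exists (lg_join c 0) => //; apply: lg_leUr.
by apply: lg_le_anti; rewrite -lg_subr_le0.
Qed.

Definition divisible (A : lgroupType) (d : nat) : Prop :=
  forall a : A, exists c : A, c *+ d = a.

Section Conjunction.
Variables (V : finType) (k : nat) (s t : 'I_k -> term V).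

(** The final [TZero] covers the empty conjunction and keeps the value nonnegative, so over Q the
    solutions are the points where the minimum 0 is attained. *)
Definition conjT : term V :=
  foldr (@TJoin _) TZero [seq tdist (s i) (t i) | i <- enum 'I_k].

Lemma conjT_le0 (A : lgroupType) (v : V -> A) :
  lg_le (eval v conjT) 0 <-> forall i, eval v (s i) = eval v (t i).
Proof.
have : lg_le (eval v conjT) 0 <-> forall i, i \in enum 'I_k ->
    eval v (s i) = eval v (t i).
  rewrite /conjT; elim: (enum _) => [|i r IH].
    by split=> // _; apply: lg_le_refl.
  rewrite [eval v _](_ : _ = lg_join (eval v (tdist (s i) (t i)))
    (eval v (foldr (@TJoin _) TZero [seq tdist (s i) (t i) | i <- r]))) //.
  rewrite lg_leUx eval_tdist_le0 IH; split=> [[e H] l|H].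
    by rewrite inE => /predU1P[->|/H].
  by split=> [|l lr]; apply: H; rewrite inE ?eqxx ?lr ?orbT.
by move=> ->; split=> H i; [apply: H; rewrite mem_enum | move=> _; apply: H].
Qed.

Lemma conjT_ge0 (x : V -> rat) : 0 <= evalQ x conjT.
Proof.
rewrite /conjT /evalQ; elim: (enum _) => [//|i r IH] /=.
by rewrite le_max IH orbT.
Qed.

End Conjunction.

Section System.
Variable phi : efd.
Let n := efd_n phi.
Let m := efd_m phi.

Definition sysT : term ('I_n + 'I_m) := conjT (efd_lhs phi) (efd_rhs phi).

Lemma sysT_ge0 (x : 'I_n + 'I_m -> rat) : 0 <= evalQ x sysT.
Proof. exact: conjT_ge0. Qed.

Definition solves (A : lgroupType) (x : 'I_n -> A) (z : 'I_m -> A) : Prop :=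
  lg_le (eval (vpair x z) sysT) 0.

Lemma solvesQ (x : 'I_n -> rat) (z : 'I_m -> rat) :
  @solves Qlg x z <-> evalQ (vpair x z) sysT <= 0.
Proof. exact: lg_leQ. Qed.

Lemma sat_solves (A : lgroupType) :
  sat A phi <-> forall x, exists2 z, @solves A x z & forall z', solves x z' -> z = z'.
Proof.
have E (x : n.-tuple A) (z : m.-tuple A) : solves (tnth x) (tnth z) <->
    forall i, eval (assign x z) (efd_lhs phi i) = eval (assign x z) (efd_rhs phi i).
  by rewrite /solves; apply: conjT_le0.
have T k (x : 'I_k -> A) : x = tnth [tuple x i | i < k].
  by apply/funext => i; rewrite tnth_mktuple.
split=> H x.
  have [z [/E Hz uz]] := H [tuple x i | i < n]; exists (tnth z); first by rewrite (T _ x).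
  by move=> z'; rewrite (T _ x) (T _ z') => /E/uz ->.
have [z Hz uz] := H (tnth x); exists [tuple z i | i < m].
split=> [|z' /E/uz ez]; first by apply/E; rewrite -T.
by apply: eq_from_tnth => i; rewrite -T ez.
Qed.

Lemma solvesQ_scale (D : rat) (x : 'I_n -> rat) (z : 'I_m -> rat) : 0 <= D ->
  @solves Qlg x z -> @solves Qlg (fun i => D * x i) (fun j => D * z j).
Proof.
rewrite !solvesQ => D0 H.
have -> : vpair (fun i => D * x i) (fun j => D * z j) = (fun v => D * vpair x z v).
  by apply/funext => -[].
by rewrite evalQ_scale // mulr_ge0_le0.
Qed.

Section NontrivialModel.
Variable A0 : lgroupType.
Hypotheses (A0phi : sat A0 phi) (A0nt : ~ trivial_lgroup A0).

Lemma solvesQ_uniq (x : 'I_n -> rat) (z z' : 'I_m -> rat) :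
  @solves Qlg x z -> @solves Qlg x z' -> z = z'.
Proof.
move=> Hz Hz'; have [b b0 bn0] := nontrivial_pos A0nt.
have [N N0 [y Hy]] := rat_common_denom (vpair x (vpair z z')).
pose scaled (u : 'I_m -> rat) (w : 'I_m -> int) := forall j, u j *+ N = (w j)%:~R.
have sub u w : scaled u w -> @solves Qlg x u ->
    @solves A0 (fun i => b *~ y (inl i)) (fun j => b *~ w j).
  move=> uw /solvesQ Hu; pose v := vpair (fun i => y (inl i)) w.
  have [k [e1 e2]] := eval_multiples v sysT b0.
  have ev : (fun i => (v i)%:~R) = (fun i => N%:R * vpair x u i).
    by apply/funext => -[i|j] /=; rewrite mulr_natl; [rewrite -Hy | rewrite uw].
  (* Homogeneity gives k <= 0, nonnegativity of [sysT] gives k >= 0. *)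
  have k0 : k = 0.
    apply/le_anti; rewrite -(ler_int rat) -(ler_int rat 0) -e1 sysT_ge0 andbT.
    by rewrite ev evalQ_scale // mulr_ge0_le0.
  rewrite /solves.
  have -> : vpair (fun i => b *~ y (inl i)) (fun j => b *~ w j) =
      (fun i => b *~ v i).
    by apply/funext => -[].
  by rewrite e2 k0 mulr0z; apply: lg_le_refl.
have [c _ uc] := iffLR (sat_solves A0) A0phi (fun i => b *~ y (inl i)).
have E1 := uc _ (sub z (fun j => y (inr (inl j))) (fun j => Hy (inr (inl j))) Hz).
have E2 := uc _ (sub z' (fun j => y (inr (inr j))) (fun j => Hy (inr (inr j))) Hz').
apply/funext => j.
have /(pos_mulrz_eq0 bn0)/eqP : b *~ (y (inr (inl j)) - y (inr (inr j))) = 0.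
  rewrite mulrzBr; apply/eqP; rewrite subr_eq0; apply/eqP.
  by move: E2; rewrite E1 => /(congr1 (fun g => g j)).
rewrite subr_eq0 => /eqP e; have := Hy (inr (inr j)); rewrite -e -Hy /=.
by move/eqP; rewrite eqr_pMn2r // => /eqP.
Qed.

(* The system along a ray: x_i is replaced by y_i w, where w is [TVar None]. *)
Definition ray_subst (y : 'I_n -> int) (v : 'I_n + 'I_m) : term (option 'I_m) :=
  match v with inl i => tmulz (y i) (TVar None) | inr j => TVar (Some j) end.

Lemma eval_ray (A : lgroupType) (y : 'I_n -> int) (v : option 'I_m -> A) :
  eval v (term_subst (ray_subst y) sysT) =
  eval (vpair (fun i => v None *~ y i) (fun j => v (Some j))) sysT.
Proof.
by rewrite eval_term_subst; apply: eval_ext => -[i|j] //=; rewrite eval_tmulz.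
Qed.

Lemma evalQ_ray (y : 'I_n -> int) (v : option 'I_m -> rat) :
  evalQ v (term_subst (ray_subst y) sysT) =
  evalQ (vpair (fun i => v None * (y i)%:~R) (fun j => v (Some j))) sysT.
Proof.
rewrite /evalQ eval_ray; apply: (@eval_ext Qlg) => -[i|j] //=.
by rewrite Qlg_mulrz mulrzr.
Qed.

(* If x had no solution in Q, the system along the ray through x would force
   w <= 0 in Q, hence in A0. *)
Lemma solvesQ_ex (x : 'I_n -> rat) : exists z, @solves Qlg x z.
Proof.
apply: contrapT => H; have [b b0 bn0] := nontrivial_pos A0nt.
have [N N0 [y Hy]] := rat_common_denom x.
have [c Hc _] := iffLR (sat_solves A0) A0phi (fun i => b *~ y i).
have := @quasi_identity_le _ (term_subst (ray_subst y) sysT) (TVar None) _ A0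
  (fun o => if o is Some j then c j else b).
rewrite eval_ray => Q; apply: bn0; apply: lg_le_anti => //; apply: Q => // v.
rewrite evalQ_ray => /solvesQ Hv; rewrite leNgt; apply/negP => v0.
rewrite -[evalQ _ _]/(v None) in v0.
(* With w = [v None] > 0, [v] solves the system at w y = (w N) x; homogeneity scales the solution
   back to [x]. *)
apply: H; exists (fun j => (v None * N%:R)^-1 * v (Some j)).
have -> : x = (fun i => (v None * N%:R)^-1 * (v None * (y i)%:~R)).
  apply/funext => i; rewrite -Hy -[x i *+ N]mulr_natr; field.
  by rewrite pnatr_eq0 -lt0n N0 gt_eqF.
apply: solvesQ_scale Hv; by rewrite invr_ge0 mulr_ge0 // ltW.
Qed.

(** Over Q, uniqueness makes the solution at w y equal to w z for w >= 0, so that denominator times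
    j-th component = numerator times w is a quasi-identity. In A it holds with w = b >= 0, and
    Bezout's identity turns it into a quotient of b. Such b suffice, every element being a
    difference of two of them. *)
Lemma solvesQ_denom (y : 'I_n -> int) (z : 'I_m -> rat) j (A : lgroupType) :
  @solves Qlg (fun i => (y i)%:~R) z -> sat A phi ->
  divisible A `|denq (z j)|%N.
Proof.
move=> Hz /sat_solves Aphi.
suff pos (b : A) : lg_le 0 b -> exists c, c *+ `|denq (z j)|%N = b.
  move=> a; have [|c1 e1] := pos (lg_join a 0); first exact: lg_leUr.
  have [|c2 e2] := pos (lg_join a 0 - a); first by rewrite lg_le_subr add0r; apply: lg_leUl.
  by exists (c1 - c2); rewrite mulrnBl e1 e2 opprB addrC subrK.
move=> b0; have [c Hc _] := Aphi (fun i => b *~ y i).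
have cE : c j *~ denq (z j) = b *~ numq (z j).
  have := @quasi_identity _ (TJoin (term_subst (ray_subst y) sysT) (TOpp (TVar None)))
    (tmulz (denq (z j)) (TVar (Some j))) (tmulz (numq (z j)) (TVar None)) _ A
    (fun o => if o is Some j then c j else b).
  rewrite !eval_tmulz; apply.
    move=> v; rewrite !evalQ_tmulz.
    rewrite [evalQ v _](_ : _ =
      Num.max (evalQ v (term_subst (ray_subst y) sysT)) (- v None)) //.
    rewrite ge_max evalQ_ray => /andP[/solvesQ Hv]; rewrite oppr_le0 => v0.
    have := solvesQ_scale v0 Hz => /(solvesQ_uniq Hv) /(congr1 (fun g => g j)).
    rewrite -[evalQ v _]/(v (Some j)) -[evalQ v (TVar None)]/(v None) => ->.
    by rewrite -[LHS]mulrzr -[RHS]mulrzr -mulrA -numqE.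
  rewrite [eval _ _](_ : _ = lg_join
     (eval (fun o : option 'I_m => if o is Some j then c j else b)
     (term_subst (ray_subst y) sysT)) (- b)) //.
  rewrite lg_leUx eval_ray; split=> //.
  by rewrite -(lg_leD2l b) subrr addr0.
have [u [v uv]] : exists u v : int, u * numq (z j) + v * denq (z j) = 1.
  have := coprime_num_den (z j).
  rewrite -[coprime _ _]/(coprimez (numq (z j)) (denq (z j))).
  by move/coprimezP => [[u v] /= uv]; exists u, v.
exists (c j *~ u + b *~ v).
rewrite pmulrn gtz0_abs ?denq_gt0 // mulrzDl mulrzAC cE -!mulrzA.
rewrite -mulrzDr mulrC uv; exact: mulr1z.
Qed.

End NontrivialModel.
End System.

(** * Piecewise linear functions *)

Definition near0 (P : rat -> Prop) : Prop :=
  exists2 d : rat, 0 < d & forall e, 0 < e -> e <= d -> P e.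

Lemma near0_ex P : near0 P -> exists2 e, 0 < e & P e.
Proof. by case=> d d0 H; exists d => //; apply: H. Qed.

Lemma near0W P Q : (forall e, 0 < e -> P e -> Q e) -> near0 P -> near0 Q.
Proof. by move=> PQ [d d0 H]; exists d => // e e0 ed; apply: PQ (H e e0 ed). Qed.

Lemma near0I P Q : near0 P -> near0 Q -> near0 (fun e => P e /\ Q e).
Proof.
move=> [d d0 H] [d' d'0 H']; exists (Num.min d d'); first by rewrite lt_min d0.
by move=> e e0; rewrite le_min => /andP[ed ed']; split; [apply: H | apply: H'].
Qed.

Lemma near0_le a : 0 < a -> near0 (fun e => e <= a).
Proof. by move=> a0; exists a. Qed.

Lemma near0_all (T : eqType) (s : seq T) (P : T -> rat -> Prop) :
  (forall t, t \in s -> near0 (P t)) -> near0 (fun e => forall t, t \in s -> P t e).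
Proof.
elim: s => [_|t s IH H]; first by exists 1.
apply: near0W (near0I (H t (mem_head _ _)) (IH _)) => [e e0 [Ht Hs] u|u us].
  by rewrite inE => /predU1P[->|/Hs].
by apply: H; rewrite inE us orbT.
Qed.

Lemma near0_gt0 (a b : rat) : 0 < a -> near0 (fun e => 0 < a + e * b).
Proof.
move=> a0; have b0 : 0 < `|b| + 1 by have := normr_ge0 b; lra.
exists (a / (`|b| + 1)); first exact: divr_gt0.
move=> e e0; rewrite ler_pdivlMr // => h.
have : - (e * `|b|) <= e * b by rewrite -mulrN ler_pM2l // lerNl -normrN ler_norm.
by lra.
Qed.

Lemma near0_neq0 (a b : rat) : a != 0 \/ b != 0 -> near0 (fun e => a + e * b != 0).
Proof.
case: (ltgtP a 0) => [a0 _|a0 _|->].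
- have /near0_gt0 H : 0 < - a by rewrite oppr_gt0.
  by apply: near0W (H (- b)) => e e0; rewrite mulrN -opprD oppr_gt0; apply: ltr0_neq0.
- by apply: near0W (near0_gt0 b a0) => e e0; apply: lt0r_neq0.
- case=> [/eqP//|b0]; exists 1 => // e e0 _; by rewrite add0r mulf_neq0 // gt_eqF.
Qed.

(** * Subdivisions of rational intervals *)

Section Cells.
Variable P : rat -> rat -> Prop.

(** Adjacent closed intervals share an endpoint, so formulas for one function on neighbouring cells
    agree there: this is how continuity is encoded. Cells of length zero are allowed. *)
Inductive cells : rat -> rat -> Prop :=
| cell a b : a <= b -> P a b -> cells a b
| cells_cat a c b : cells a c -> cells c b -> cells a b.

Lemma cells_le a b : cells a b -> a <= b.
Proof. by elim=> // a' c b' _ ac _; apply: le_trans. Qed.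

Definition hereditary := forall a b a' b', P a b -> a <= a' -> a' <= b' -> b' <= b -> P a' b'.

Lemma cells_sub a b a' b' : hereditary -> cells a b ->
  a <= a' -> a' <= b' -> b' <= b -> cells a' b'.
Proof.
move=> h H; elim: H a' b' => {a b} [a b ab Pab|a c b ac IH1 cb IH2] a' b' aa' a'b' b'b.
  by apply: cell => //; apply: h Pab _ _ _.
case: (leP b' c) => [b'c|/ltW cb']; first exact: IH1.
case: (leP c a') => [ca'|/ltW a'c]; first exact: IH2.
by apply: (cells_cat (c := c)); [apply: IH1 | apply: IH2].
Qed.

Lemma cells_start a b : cells a b -> a < b -> exists2 b', a < b' <= b & P a b'.
Proof.
elim=> {a b} [a b _ Pab ab|a c b ac IH1 cb IH2 ab]; first by exists b; rewrite ?ab /=.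
have := cells_le ac; rewrite le_eqVlt => /predU1P[e|/IH1[b' /andP[ab' b'c] H]].
  by subst c; apply: IH2.
by exists b' => //; rewrite ab' (le_trans b'c) // cells_le.
Qed.

End Cells.

Lemma cellsW (P Q : rat -> rat -> Prop) a b : hereditary P ->
  (forall c d, a <= c -> c <= d -> d <= b -> P c d -> cells Q c d) ->
  cells P a b -> cells Q a b.
Proof.
move=> hP PQ H; elim: H PQ => {a b} [a b ab Pab|a c b ac IH1 cb IH2] PQ.
  by apply: PQ.
apply: (cells_cat (c := c)); [apply: IH1 | apply: IH2] => d e h1 h2 h3; apply: PQ => //.
  exact: le_trans h3 (cells_le cb).
exact: le_trans (cells_le ac) h1.
Qed.

Lemma cellsI (P Q : rat -> rat -> Prop) a b : hereditary P -> hereditary Q ->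
  cells P a b -> cells Q a b -> cells (fun c d => P c d /\ Q c d) a b.
Proof.
move=> hP hQ HP HQ; apply: cellsW HP => // c d ac cd db Pcd.
apply: cellsW (cells_sub hQ HQ ac cd db) => // c' d' h1 h2 h3 Qcd.
by apply: cell => //; split=> //; apply: hP Pcd _ _ _.
Qed.

Lemma cells_all (T : eqType) (s : seq T) (P : T -> rat -> rat -> Prop) a b : a <= b ->
  (forall t, t \in s -> hereditary (P t)) -> (forall t, t \in s -> cells (P t) a b) ->
  cells (fun c d => forall t, t \in s -> P t c d) a b.
Proof.
move=> ab; elim: s => [|t s IH] hP H; first exact: cell.
have : cells (fun c d => P t c d /\ forall t, t \in s -> P t c d) a b.
  apply: cellsI.
  - by apply: hP; rewrite mem_head.
  - by move=> x y x' y' Hs h1 h2 h3 u us; apply: (hP u) (Hs u us) _ _ _;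
      rewrite ?inE ?us ?orbT.
  - by apply: H; rewrite mem_head.
  - by apply: IH => u us; [apply: hP | apply: H]; rewrite inE us orbT.
apply: cellsW.
  move=> x y x' y' [Ht Hs] h1 h2 h3; split.
    by apply: (hP t) Ht _ _ _; rewrite ?mem_head.
  by move=> u us; apply: (hP u) (Hs u us) _ _ _; rewrite ?inE ?us ?orbT.
move=> c d _ cd _ [Ht Hs]; apply: cell => // u.
by rewrite inE => /predU1P[->|/Hs].
Qed.

Definition affine (g : rat -> rat) (a b : rat) : Prop :=
  exists c d, forall t, a <= t -> t <= b -> g t = c + d * t.

Lemma affine_hereditary g : hereditary (affine g).
Proof.
move=> a b a' b' [c [d H]] aa' a'b' b'b; exists c, d => t at' tb.
by apply: H; [apply: le_trans at' | apply: le_trans tb _].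
Qed.

Lemma affine_ge0 (c d a b t : rat) : 0 <= c + d * a -> 0 <= c + d * b ->
  a <= t -> t <= b -> 0 <= c + d * t.
Proof. by move=> ha hb at' tb; case: (leP 0 d) => d0; nra. Qed.

(** One cut suffices, at the zero [r] of the difference when that difference changes sign. *)
Lemma cells_max (g h : rat -> rat) a b : a <= b -> affine g a b -> affine h a b ->
  cells (affine (fun t => Num.max (g t) (h t))) a b.
Proof.
move=> ab [c [d Hg]] [c' [d' Hh]].
have base p q : a <= p -> p <= q -> q <= b -> 0 <= (c - c') + (d - d') * p ->
    0 <= (c - c') + (d - d') * q -> affine (fun t => Num.max (g t) (h t)) p q.
  move=> ap pq qb hp hq; exists c, d => t pt tq.
  rewrite Hg ?Hh ?(le_trans ap) ?(le_trans tq) //; apply/max_idPl.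
  by have := affine_ge0 hp hq pt tq; lra.
have base' p q : a <= p -> p <= q -> q <= b -> (c - c') + (d - d') * p <= 0 ->
    (c - c') + (d - d') * q <= 0 -> affine (fun t => Num.max (g t) (h t)) p q.
  move=> ap pq qb hp hq; exists c', d' => t pt tq.
  rewrite Hg ?Hh ?(le_trans ap) ?(le_trans tq) //; apply/max_idPr.
  have hp' : 0 <= (c' - c) + (d' - d) * p by lra.
  have hq' : 0 <= (c' - c) + (d' - d) * q by lra.
  by have := affine_ge0 hp' hq' pt tq; lra.
case: (leP 0 ((c - c') + (d - d') * a)) => ha;
  case: (leP 0 ((c - c') + (d - d') * b)) => hb.
- by apply: cell => //; apply: base.
- have d0 : d - d' < 0 by nra.
  pose r := - (c - c') / (d - d').
  have er : (c - c') + (d - d') * r = 0 by rewrite /r; field; rewrite lt_eqF.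
  have ar : a <= r by nra.
  have rb : r <= b by nra.
  apply: (cells_cat (c := r)); apply: cell => //; [apply: base | apply: base'] => //; lra.
- have d0 : 0 < d - d' by nra.
  pose r := - (c - c') / (d - d').
  have er : (c - c') + (d - d') * r = 0 by rewrite /r; field; rewrite gt_eqF.
  have ar : a <= r by nra.
  have rb : r <= b by nra.
  apply: (cells_cat (c := r)); apply: cell => //; [apply: base' | apply: base] => //; lra.
- by apply: cell => //; apply: base' => //; apply: ltW.
Qed.

Lemma cells_evalQ (V : finType) (p q : V -> rat) (T : term V) a b : a <= b ->
  cells (affine (fun t => evalQ (fun i => p i + t * q i) T)) a b.
Proof.
move=> ab.
have opp g c d : affine g c d -> affine (fun t => - g t) c d.
  by move=> [e [f H]]; exists (- e), (- f) => t ct td; rewrite H //; ring.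
have cellsN g : cells (affine g) a b -> cells (affine (fun t => - g t)) a b.
  apply: cellsW => [|c d _ cd _ H]; first exact: affine_hereditary.
  by apply: cell => //; apply: opp.
have cells_maxT g h : cells (affine g) a b -> cells (affine h) a b ->
    cells (affine (fun t => Num.max (g t) (h t))) a b.
  move=> Hg Hh; have := cellsI (@affine_hereditary g) (@affine_hereditary h) Hg Hh.
  apply: cellsW => [c d c' d' [H1 H2] h1 h2 h3|c d _ cd _ [H1 H2]].
    by split; [apply: affine_hereditary H1 _ _ _|apply: affine_hereditary H2 _ _ _].
  exact: cells_max.
rewrite /evalQ.
elim: T => [i||t IH|t IH t' IH'|t IH t' IH'|t IH t' IH'] /=.
- by apply: cell => //; exists (p i), (q i) => t _ _; rewrite mulrC.
- by apply: cell => //; exists 0, 0 => t _ _; rewrite mul0r addr0.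
- exact: cellsN.
- have := cellsI (@affine_hereditary _) (@affine_hereditary _) IH IH'.
  apply: cellsW => [c d c' d' [H1 H2] h1 h2 h3|c d _ cd _ [[e [f H]] [e' [f' H']]]].
    by split; [apply: affine_hereditary H1 _ _ _|apply: affine_hereditary H2 _ _ _].
  apply: cell => //; exists (e + e'), (f + f') => s cs sd.
  by rewrite [LHS](congr2 +%R (H s cs sd) (H' s cs sd)); ring.
- exact: cells_maxT.
- have := cellsN _ (cells_maxT _ _ (cellsN _ IH) (cellsN _ IH')).
  apply: cellsW; first exact: affine_hereditary.
  move=> c d _ cd _ [e [f H]]; apply: cell => //; exists e, f => s cs sd.
  by rewrite -(H s cs sd) oppr_max !opprK.
Qed.

(** * Piecewise linearity of the solution function *)

Section PiecewiseLinear.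
Variables (n m : nat) (T : term ('I_n + 'I_m)) (f : 'rV[rat]_n -> 'rV[rat]_m).
Hypothesis T_ge0 : forall x, 0 <= evalQ x T.
Hypothesis fP : forall (x : 'rV[rat]_n) (z : 'rV[rat]_m),
  evalQ (vpair (x 0) (z 0)) T <= 0 <-> z = f x.

Definition linear_piece (M : 'M[rat]_(n, m)) (x : 'rV[rat]_n) : Prop := f x = x *m M.

Lemma vpair_line (x u : 'rV[rat]_n) (z v : 'rV[rat]_m) e :
  vpair ((x + e *: u) 0) ((z + e *: v) 0) =
  (fun i => vpair (x 0) (z 0) i + e * vpair (u 0) (v 0) i).
Proof. by apply/funext => -[i|j] /=; rewrite !mxE. Qed.

Lemma fZ D x : 0 <= D -> f (D *: x) = D *: f x.
Proof.
move=> D0; apply/esym/fP.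
have -> : vpair ((D *: x) 0) ((D *: f x) 0) = (fun i => D * vpair (x 0) (f x 0) i).
  by apply/funext => -[i|j] /=; rewrite !mxE.
by rewrite evalQ_scale // mulr_ge0_le0 //; apply/fP.
Qed.

(* Uniqueness of the solution makes it a vertex: the forms that attain the
   maximum at (x, f x) determine f x from x. *)
Lemma finitely_many_pieces : exists Ms : seq 'M[rat]_(n, m),
  forall x, exists2 M, M \in Ms & linear_piece M x.
Proof.
have [cs [ds nf]] := normal_form T.
pose L := cs ++ ds; pose k := size L; pose F (l : 'I_k) : form _ := nth 0 L l.
(* For an active set [K], the equations [F l] (x, z) = w in the unknowns (z, w) read (z, w) B = - x
   A; the row of entries -1 belongs to w. Columns outside [K] are zero, so the sizes do not depend
   on [K]. *)
pose A (K : {set 'I_k}) : 'M[rat]_(n, k) :=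
  \matrix_(i, l) if l \in K then (F l (inl i))%:~R else 0.
pose B (K : {set 'I_k}) : 'M[rat]_(m + 1, k) :=
  col_mx (\matrix_(j, l) if l \in K then (F l (inr j))%:~R else 0)
         (\row_l if l \in K then - 1 else 0).
exists [seq lsubmx (- A K *m pinvmx (B K)) | K <- enum {:{set 'I_k}}] => x.
have [c [d [cin din tc td eT]]] := evalQ_normal nf (vpair (x 0) (f x 0)).
pose p := vpair (x 0) (f x 0); pose w := lin c p.
(* At a solution the two maxima of the normal form coincide, so one value [w] bounds all forms of
   [L]. *)
have wd : lin d p = w.
  apply/eqP; rewrite eq_sym -subr_eq0 -eT eq_le T_ge0 andbT.
  exact/fP.
have Lle c' : c' \in L -> lin c' p <= w.
  by rewrite mem_cat => /orP[/tc//|/td]; rewrite wd.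
pose K := [set l | lin (F l) p == w].
exists (lsubmx (- A K *m pinvmx (B K))).
  by apply: map_f; rewrite mem_enum.
have linF l (a : 'rV[rat]_n) (b : 'rV[rat]_m) : lin (F l) (vpair (a 0) (b 0)) =
    \sum_i a 0 i * (F l (inl i))%:~R + \sum_j b 0 j * (F l (inr j))%:~R.
  rewrite lin_ratE big_sumType /=.
  by congr (_ + _); apply: eq_bigr => i _; rewrite mulrC.
have mulB (b : 'rV[rat]_m) (s : rat) l : (row_mx b s%:M *m B K) 0 l =
    if l \in K then lin (F l) (vpair ((0 : 'rV[rat]_n) 0) (b 0)) - s else 0.
  rewrite mul_row_col mxE linF; case: ifP => lK.
    rewrite [X in _ = X + _ - _]big1 ?add0r; last by move=> i _; rewrite mxE mul0r.
    rewrite !mxE big_ord1 !mxE lK eqxx mulr1n mulrN1; congr (_ - _).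
    by apply: eq_bigr => j _; rewrite mxE lK.
  rewrite !mxE big1 ?big1 ?addr0 // => i _; rewrite !mxE lK mulr0 //.
have fK : row_mx (f x) w%:M *m B K = x *m - A K.
  apply/rowP => l; rewrite mulB mulmxN !mxE.
  under eq_bigr do rewrite mxE.
  case: ifP => lK; last by rewrite big1 ?oppr0 // => i _; rewrite mulr0.
  have : lin (F l) p == w by move: lK; rewrite inE.
  rewrite !linF [X in X + _ - w]big1 ?add0r; last by move=> i _; rewrite mxE mul0r.
  by move=> /eqP <-; rewrite opprD addrA addrAC subrr add0r.
(* A kernel vector (v, mu) moves all active forms at the same rate mu when z moves along v, while
   the inactive ones stay below for a short time. The point remains a solution, so uniqueness gives
   v = 0, and then mu = 0. *)
have freeB : row_free (B K).
  apply: inj_row_free => y; rewrite -(hsubmxK y).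
  set v := lsubmx y; set mu := rsubmx y 0 0.
  have -> : rsubmx y = mu%:M by rewrite [LHS]mx11_scalar.
  move=> y0; have active l : l \in K -> lin (F l) (vpair ((0 : 'rV[rat]_n) 0) (v 0)) = mu.
    move=> lK; have := mulB v mu l; rewrite y0 mxE lK => /esym/eqP.
    by rewrite subr_eq0 => /eqP.
  pose q := vpair ((0 : 'rV[rat]_n) 0) (v 0).
  have lin_line c' e : lin c' (fun i => p i + e * q i) = lin c' p + e * lin c' q.
    rewrite -[RHS]addrC -lin_rat_linear; congr lin; apply/funext => i.
    by rewrite addrC.
  have activeL c' : c' \in L -> lin c' p = w -> lin c' q = mu.
    move=> c'L c'w; have lt : (index c' L < k)%N by rewrite index_mem.
    have e : F (Ordinal lt) = c' by rewrite /F /= nth_index.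
    by rewrite -e; apply: active; rewrite inE e c'w.
  have [e e0 He] : exists2 e, 0 < e &
      forall c', c' \in L -> lin c' p + e * lin c' q <= w + e * mu.
    apply/near0_ex/near0_all => c' c'L.
    have := Lle c' c'L; rewrite le_eqVlt => /predU1P[e|lt].
      by exists 1 => // e' _ _; rewrite e activeL.
    have /near0_gt0 H : 0 < w - lin c' p by rewrite subr_gt0.
    by apply: near0W (H (mu - lin c' q)) => e' _; rewrite mulrBr; lra.
  have v0 : v = 0.
    have /fP : evalQ (vpair (x 0) ((f x + e *: v) 0)) T <= 0.
      have -> : vpair (x 0) ((f x + e *: v) 0) = (fun i => p i + e * q i).
        by apply/funext => -[i|j] /=; rewrite !mxE ?mulr0 ?addr0.
      have [c' [d' [c'in d'in tc' td' ->]]] := evalQ_normal nf (fun i => p i + e * q i).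
      rewrite subr_le0; apply: le_trans (td' d din); rewrite !lin_line.
      have dL : d \in L by rewrite mem_cat din orbT.
      rewrite wd (activeL d) //; apply: He; by rewrite mem_cat c'in.
    move/eqP; rewrite -subr_eq0 addrAC subrr add0r scaler_eq0 gt_eqF //=.
    by move/eqP.
  have cL : c \in L by rewrite mem_cat cin.
  have mu0 : mu = 0.
    rewrite -(activeL c) // /q v0 lin_ratE big1 // => -[i|j] _ /=; by rewrite mxE mulr0.
  by rewrite v0 mu0 (raddf0 (@scalar_mx _ _)) row_mx0.
rewrite /linear_piece mulmx_lsub mulmxA -fK mulmxKp //.
by rewrite row_mxKl.
Qed.

(** Inserting the candidate (x + t u) M into [T] gives a nonnegative, piecewise affine function of t
    that vanishes exactly where M is right. If it is affine on a cell and zero at the midpoint, it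
    is zero on the whole cell. *)
Lemma line_pieces (Ms : seq 'M[rat]_(n, m)) :
  (forall x, exists2 M, M \in Ms & linear_piece M x) ->
  forall (x u : 'rV[rat]_n), cells (fun a b => exists2 M, M \in Ms &
    forall t, a <= t -> t <= b -> linear_piece M (x + t *: u)) 0 1.
Proof.
move=> HMs x u.
pose g M t := evalQ (vpair ((x + t *: u) 0) (((x + t *: u) *m M) 0)) T.
have g0 M t : (g M t <= 0) <-> linear_piece M (x + t *: u).
  by rewrite /g fP /linear_piece; split=> ->.
have : cells (fun c d => forall M, M \in Ms -> affine (g M) c d) 0 1.
  apply: cells_all => // M _; first exact: affine_hereditary.
  have -> : g M = (fun t => evalQ (fun i => vpair (x 0) ((x *m M) 0) i +
      t * vpair (u 0) ((u *m M) 0) i) T).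
    by apply/funext => t; rewrite /g mulmxDl -scalemxAl vpair_line.
  exact: cells_evalQ.
apply: cellsW => [a b a' b' H aa' ab' bb' M MMs|a b _ ab _ H].
  exact: affine_hereditary (H M MMs) aa' ab' bb'.
have [M MMs Mmid] := HMs (x + ((a + b) / 2) *: u).
apply: cell => //; exists M => // t ta tb; apply/g0.
have [c [d Hg]] := H M MMs.
(* At t and at its mirror image a + b - t the values are nonnegative, and their mean is the value 0
   at the midpoint. *)
have := T_ge0 (vpair ((x + (a + b - t) *: u) 0) (((x + (a + b - t) *: u) *m M) 0)).
rewrite -/(g M _) Hg; [|lra|lra]; rewrite Hg //.
by move/g0: Mmid; rewrite Hg; [lra|lra|lra].
Qed.

End PiecewiseLinear.

(** * Max-min representation *)

Section MaxMin.
Variables (n : nat) (g : 'rV[rat]_n -> rat) (cs : seq 'cV[rat]_n).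
Variable good : rat -> Prop.

Definition cval (x : 'rV[rat]_n) (c : 'cV[rat]_n) : rat := (x *m c) 0 0.

Hypothesis g_line : forall x u, cells (fun a b => exists2 c, c \in cs &
  forall t, a <= t -> t <= b -> g (x + t *: u) = cval (x + t *: u) c) 0 1.
Hypothesis gZ : forall D x, 0 <= D -> g (D *: x) = D * g x.
Hypothesis good_int : forall y : 'rV[int]_n, good (g (map_mx intr y)).
Hypothesis goodB : forall r s, good r -> good s -> good (r - s).

Lemma cval_line x u t c : cval (x + t *: u) c = cval x c + t * cval u c.
Proof. by rewrite /cval mulmxDl -scalemxAl !mxE. Qed.

Lemma cvalB x c d : cval x (c - d) = cval x c - cval x d.
Proof. by rewrite /cval mulmxBr !mxE. Qed.

Lemma cval_delta i c : cval (delta_mx 0 i) c = c i 0.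
Proof. by rewrite /cval -rowE mxE. Qed.

(** Points off the finitely many hyperplanes on which two candidate pieces agree. *)
Definition regular (y : 'rV[rat]_n) : Prop :=
  forall c d, c \in cs -> d \in cs -> cval y c = cval y d -> c = d.

(** The difference of two distinct pieces along the line is affine in [e]; it vanishes identically
    only if they agree at both [x] and [u]. *)
Lemma near_regular x u a : regular x \/ regular u ->
  near0 (fun e => regular (x + (a + e) *: u)).
Proof.
move=> reg; have : near0 (fun e => forall c, c \in cs -> forall d, d \in cs ->
    cval (x + (a + e) *: u) c = cval (x + (a + e) *: u) d -> c = d).
  apply: near0_all => c ccs; apply: near0_all => d dcs.
  have [->|/eqP cd] := eqVneq c d; first by exists 1.
  pose A := cval x c - cval x d; pose B := cval u c - cval u d.
  have /near0_neq0 : A + a * B != 0 \/ B != 0.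
    have [B0|] := eqVneq B 0; last by right.
    left; rewrite B0 mulr0 addr0 subr_eq0; apply/eqP.
    case: reg => [reg /reg|reg]; first by auto.
    by move/eqP: B0; rewrite subr_eq0 => /eqP /reg; auto.
  apply: near0W => e _ /eqP ne; rewrite !cval_line => h; case: ne.
  by rewrite /A /B; move: h; rewrite !mulrDl; lra.
by apply: near0W => e _ H c d ccs dcs; apply: H.
Qed.

(** Hyperplanes are avoided one at a time: a small step along a suitable coordinate axis leaves the
    new one without reaching the others. *)
Lemma ex_nonzero_dir (ds : seq 'cV[rat]_n) : 0 \notin ds ->
  exists u, forall d, d \in ds -> cval u d != 0.
Proof.
elim: ds => [_|d ds IH]; first by exists 0.
rewrite inE negb_or eq_sym => /andP[d0 /IH[u Hu]].
have [i di] : exists i, d i 0 != 0.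
  apply: contrapT => H; move/eqP: d0; apply; apply/colP => i; rewrite mxE.
  by apply/eqP; apply: contrapT => /negP h; apply: H; exists i.
have [e _ He] : exists2 e, 0 < e & forall d', d' \in d :: ds ->
    cval u d' + e * cval (delta_mx 0 i) d' != 0.
  apply/near0_ex/near0_all => d'; rewrite inE => /predU1P[->|/Hu H].
    by apply: near0_neq0; right; rewrite cval_delta.
  by apply: near0_neq0; left.
by exists (u + e *: delta_mx 0 i) => d' /He; rewrite cval_line.
Qed.

Lemma ex_regular : exists u, regular u.
Proof.
have [|u Hu] := @ex_nonzero_dir [seq d <- [seq c - c' | c <- cs, c' <- cs] | d != 0].
  by rewrite mem_filter eqxx.
exists u => c d ccs dcs e; apply/eqP; rewrite -subr_eq0; apply/negPn/negP => ne.
have : cval u (c - d) != 0.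
  by apply: Hu; rewrite mem_filter ne; apply/allpairsP; exists (c, d).
by rewrite cvalB e subrr eqxx.
Qed.

Lemma g_germ x u : exists2 c, c \in cs &
  exists2 b, 0 < b & forall t, 0 <= t -> t <= b -> g (x + t *: u) = cval (x + t *: u) c.
Proof.
have [b' /andP[b0 _] [c ccs H]] := cells_start (g_line x u) ltr01.
by exists c => //; exists b'.
Qed.

(* Near a regular point g coincides with c, so the entries of c are differences
   of values of g at integer points. *)
Lemma regular_good y c i : regular y -> c \in cs -> g y = cval y c -> good (c i 0).
Proof.
move=> reg ccs gy; have [c' c'cs [b b0 Hb]] := g_germ y (delta_mx 0 i).
have ec : c' = c.
  apply: reg => //; rewrite -gy; have := Hb 0 (lexx _) (ltW b0).
  by rewrite scale0r addr0.
rewrite {c' c'cs}ec in Hb.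
have [N N0 [z Hz]] := rat_common_denom (fun i => y 0 i).
pose k := Num.bound b^-1; have kb : b^-1 < k%:R.
  by apply: archi_boundP; rewrite invr_ge0 ltW.
have k0 : 0 < k%:R :> rat by apply: lt_trans kb; rewrite invr_gt0.
have NQ : 0 < N%:R :> rat by rewrite ltr0n.
(* The factor N makes D y integral; the factor k > 1/b keeps the step 1/D inside the germ at [y]. *)
pose D : rat := (N * k)%:R; have D0 : 0 < D by rewrite /D natrM mulr_gt0.
have Db : D^-1 <= b.
  rewrite -[b]invrK lef_pV2 ?posrE ?invr_gt0 // /D natrM.
  apply: le_trans (ltW kb) _; by rewrite ler_peMl ?ler1n // ltW.
pose y1 : 'rV[int]_n := \row_l (z l * k%:Z).
have y1E : map_mx intr y1 = D *: y.
  apply/rowP => l; rewrite !mxE rmorphM /= -Hz /D natrM -[y 0 l *+ N]mulr_natr.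
  by rewrite -pmulrn; ring.
pose y2 : 'rV[int]_n := y1 + delta_mx 0 i.
have y2E : map_mx intr y2 = D *: (y + D^-1 *: delta_mx 0 i).
  rewrite map_mxD y1E map_delta_mx scalerDr scalerA divff ?gt_eqF // scale1r.
  by [].
have -> : c i 0 = g (map_mx intr y2) - g (map_mx intr y1).
  have iD0 : 0 <= D^-1 by rewrite invr_ge0 ltW.
  rewrite y1E y2E !gZ ?(ltW D0) // gy (Hb _ iD0 Db) cval_line cval_delta.
  by rewrite mulrDr mulrA divff ?gt_eqF // mul1r addrAC subrr add0r.
exact: goodB.
Qed.

(* Otherwise, going from y to x, every piece that is above the chord of g where
   it starts stays strictly above it, so that g x would be above itself. *)
Lemma separating_piece x y : regular y -> exists2 c, c \in cs &
  [/\ forall i, good (c i 0), g y <= cval y c & cval x c <= g x].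
Proof.
move=> reg; apply: contrapT => H.
have noc c : c \in cs -> (forall i, good (c i 0)) -> g y <= cval y c -> g x < cval x c.
  by move=> ccs gc gy; rewrite ltNge; apply/negP => gx; apply: H; exists c.
pose u := x - y; pose h t := g (y + t *: u) - (g y + t * (g x - g y)).
suff step a b : cells (fun a b => exists2 c, c \in cs &
    forall t, a <= t -> t <= b -> g (y + t *: u) = cval (y + t *: u) c) a b ->
    0 <= a -> b <= 1 -> a < b -> 0 <= h a -> 0 < h b.
  have := step 0 1 (g_line y u) (lexx _) (lexx _) ltr01.
  rewrite /h scale0r scale1r addr0 mul0r mul1r addr0 subrr /u !subrKC subrr.
  by rewrite ltxx => /(_ (lexx _)).
elim=> {a b} [a b _ [c ccs Hc]|a c b ac IH1 cb IH2] a0 b1 ab ha.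
  have gc i : good (c i 0).
    (* A cell of positive length contains a regular point just to the right of [a], since the line
       starts at the regular point [y]. *)
    have [e e0 [re eb]] : exists2 e, 0 < e & regular (y + (a + e) *: u) /\ e <= b - a.
      apply/near0_ex/near0I; last by apply: near0_le; rewrite subr_gt0.
      by apply: near_regular; left.
    apply: (regular_good _ re) => //; apply: Hc; lra.
  (* If the piece minus the chord is >= 0 at [a] and <= 0 at [b], it is nonincreasing, hence >= 0 at
     0. Then [noc] makes it positive at 1, although 1 lies beyond [b]. *)
  rewrite ltNge; apply/negP => hb; move: ha hb; rewrite /h.
  rewrite (Hc a (lexx _) (ltW ab)) (Hc b (ltW ab) (lexx _)) !cval_line.
  have -> : cval u c = cval x c - cval y c by rewrite /u /cval mulmxBl !mxE.
  set p := cval y c; set q := cval x c => ha hb.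
  have p0 : g y <= p by nra.
  have := noc c ccs gc p0; rewrite -/q => xq.
  nra.
have := cells_le ac; rewrite le_eqVlt => /predU1P[e|ac'].
  by subst c; apply: IH2.
have c1 : c <= 1 := le_trans (cells_le cb) b1.
have := IH1 a0 c1 ac' ha => hc.
have := cells_le cb; rewrite le_eqVlt => /predU1P[e|cb'].
  by subst c.
by apply: IH2 => //; [apply: le_trans a0 (ltW ac') | apply: ltW].
Qed.

(** The lists are the good pieces lying above g at some regular y, so that g is the maximum over y
    of their minima. [separating_piece] shows that no minimum exceeds g; the value of g at x is
    reached by a regular y close to x. *)
Lemma max_min_representation : exists Y : seq (seq 'cV[rat]_n),
  (forall ys (c : 'cV[rat]_n) i, ys \in Y -> c \in ys -> good (c i 0)) /\
  forall x, (forall ys, ys \in Y -> exists2 c, c \in ys & cval x c <= g x) /\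
    exists2 ys, ys \in Y & forall c, c \in ys -> g x <= cval x c.
Proof.
pose gcs := [seq c : 'cV[rat]_n <- cs | `[< forall i, good (c i 0) >]].
pose above y := [seq c <- gcs | g y <= cval y c].
(* Regular points are infinite in number, sublists of [gcs] are not: Boolean masks enumerate them,
   and a classical test keeps those of the form [above y]. *)
pose Y := [seq mask (tval b) gcs | b <- enum {: (size gcs).-tuple bool} &
  `[< exists2 y, regular y & mask (tval b) gcs = above y >]].
have YP ys : ys \in Y <-> exists2 y, regular y & ys = above y.
  split=> [/mapP[b]|[y reg ->]].
    by rewrite mem_filter => /andP[/asboolP[y reg e] _ ->]; exists y.
  have sz : size (map (fun c => g y <= cval y c) gcs) == size gcs by rewrite size_map.
  have e : mask (tval (Tuple sz)) gcs = above y by rewrite /above filter_mask.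
  rewrite -e; apply: map_f; rewrite mem_filter mem_enum andbT.
  by apply/asboolP; exists y.
have gcsP c : c \in gcs -> c \in cs /\ forall i, good (c i 0).
  by rewrite mem_filter => /andP[/asboolP].
exists Y; split=> [ys c i /YP[y _ ->]|x].
  by rewrite mem_filter => /andP[_ /gcsP[]].
split=> [ys /YP[y reg ->]|].
  have [c ccs [gc gy gx]] := separating_piece x reg; exists c => //.
  by rewrite !mem_filter gy ccs andbT; apply/asboolP.
have [u ureg] := ex_regular.
have [c0 c0cs [b b0 Hb]] := g_germ x u.
have gx : g x = cval x c0 by have := Hb 0 (lexx _) (ltW b0); rewrite scale0r addr0.
(* The regular point is taken so near to [x] that g is still given by [c0] and pieces strictly below
   g at [x] are still strictly below it. *)
have [e e0 [reg [eb He]]] : exists2 e, 0 < e & regular (x + (0 + e) *: u) /\ e <= b /\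
    forall c, c \in cs -> cval x c < g x -> cval (x + e *: u) c < cval (x + e *: u) c0.
  apply/near0_ex/near0I; first by apply: near_regular; right.
  apply: near0I; first exact: near0_le.
  apply: near0_all => c ccs.
  case: (ltP (cval x c) (g x)) => [lt|_]; last by exists 1.
  have /near0_gt0 H : 0 < g x - cval x c by rewrite subr_gt0.
  apply: near0W (H (cval u c0 - cval u c)) => e _; rewrite !cval_line -gx mulrBr; lra.
rewrite add0r in reg; exists (above (x + e *: u)); first by apply/YP; exists (x + e *: u).
move=> c; rewrite mem_filter => /andP[le /gcsP[ccs _]]; rewrite leNgt; apply/negP => lt.
by move: le; rewrite leNgt (Hb e (ltW e0) eb) He.
Qed.

End MaxMin.

(** * EFD-sentences as divisibility conditions *)

Lemma divisibleM (A : lgroupType) a b :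
  divisible A (a * b) <-> divisible A a /\ divisible A b.
Proof.
split=> [H|[Ha Hb] x].
  by split=> x; have [c <-] := H x; [exists (c *+ b) | exists (c *+ a)];
    rewrite -mulrnA // mulnC.
have [c <-] := Ha x; have [c' <-] := Hb c; by exists c'; rewrite mulrnA mulrnAC.
Qed.

Lemma divisible_prod (A : lgroupType) (I : finType) (d : I -> nat) :
  divisible A (\prod_i d i)%N <-> forall i, divisible A (d i).
Proof.
split=> [H i|H]; first by move: H; rewrite (bigD1 i) //= divisibleM => -[].
apply: big_ind => [x|a b Ha Hb|i _] //; first by exists x.
by apply/divisibleM.
Qed.

Section MaxMinTerms.
Variables (V : finType) (T : eqType).
Implicit Types (F : T -> term V) (s : seq T).

(** The fold starts from the head of the list, since starting from 0 would put 0 into the maximum;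
    [TZero] serves the empty list only. *)
Definition tmax F s : term V :=
  foldr (@TJoin V) (head TZero (map F s)) (map F s).

Definition tmin F s : term V := TOpp (tmax (fun t => TOpp (F t)) s).

Lemma evalQ_tmax_ge x F s t : t \in s -> evalQ x (F t) <= evalQ x (tmax F s).
Proof.
rewrite /tmax /evalQ; elim: s (head _ _) => [|u s IH] t0; first by rewrite in_nil.
rewrite inE /= le_max => /predU1P[->|/IH H]; first by rewrite lexx.
by rewrite H orbT.
Qed.

Lemma evalQ_tmax_le x F s b : s != [::] ->
  (forall t, t \in s -> evalQ x (F t) <= b) -> evalQ x (tmax F s) <= b.
Proof.
case: s => // u s _ H; rewrite /tmax [head _ _]/=.
have : evalQ x (F u) <= b by apply: H; rewrite mem_head.
have : forall t, t \in u :: s -> evalQ x (F t) <= b by [].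
move: {H}(u :: s) (F u) => r t0 H b0; rewrite /evalQ in H b0 *.
elim: r H => [//|v r IH] H /=; rewrite ge_max IH ?andbT; first by apply: H; rewrite mem_head.
by move=> w wr; apply: H; rewrite inE wr orbT.
Qed.

Lemma evalQ_tmin_le x F s t : t \in s -> evalQ x (tmin F s) <= evalQ x (F t).
Proof.
by move=> ts; rewrite -[leLHS]/(- _) lerNl; apply: (evalQ_tmax_ge x (fun t => TOpp (F t))).
Qed.

Lemma evalQ_tmin_ge x F s b : s != [::] ->
  (forall t, t \in s -> b <= evalQ x (F t)) -> b <= evalQ x (tmin F s).
Proof.
move=> s0 H; rewrite -[leRHS]/(- _) lerNr; apply: evalQ_tmax_le => // t ts.
by rewrite -[leLHS]/(- _) lerN2; apply: H.
Qed.

End MaxMinTerms.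

Definition tlin n (k : 'I_n -> int) : term 'I_n :=
  foldr (@TAdd _) TZero [seq tmulz (k i) (TVar i) | i <- enum 'I_n].

Lemma evalQ_tlin n (k : 'I_n -> int) (x : 'I_n -> rat) :
  evalQ x (tlin k) = \sum_i x i * (k i)%:~R.
Proof.
rewrite /tlin -[RHS]big_enum /=; elim: (enum _) => [|i s IH]; first by rewrite big_nil.
rewrite big_cons -IH /= mulrzr -(evalQ_tmulz x (k i) (TVar i)) //.
Qed.

(** * Explicit solution of the system over Q *)

Section ExplicitSolution.
Variables (phi : efd) (A0 : lgroupType).
Hypotheses (A0phi : sat A0 phi) (A0nt : ~ trivial_lgroup A0).
Let n := efd_n phi.
Let m := efd_m phi.

Definition good_denom (d : nat) : Prop :=
  (0 < d)%N /\ forall A, sat A phi -> divisible A d.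

Definition good (r : rat) : Prop :=
  exists2 d, good_denom d & exists k : int, r *+ d = k%:~R.

Lemma good_denomM d d' : good_denom d -> good_denom d' -> good_denom (d * d').
Proof.
move=> [d0 H] [d0' H']; split; first by rewrite muln_gt0 d0.
by move=> A HA; apply/divisibleM; split; [apply: H | apply: H'].
Qed.

Lemma goodB r s : good r -> good s -> good (r - s).
Proof.
move=> [d dg [k ek]] [d' dg' [k' ek']]; exists (d * d')%N; first exact: good_denomM.
exists (k *+ d' - k' *+ d).
by rewrite mulrnBl mulrnA ek [(d * d')%N]mulnC mulrnA ek' rmorphB !rmorphMn.
Qed.

Lemma common_good_denom (s : seq rat) : (forall r, r \in s -> good r) ->
  exists2 d, good_denom d & forall r, r \in s -> exists k : int, r *+ d = k%:~R.
Proof.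
elim: s => [_|r s IH H].
  by exists 1%N => //; split=> // A _ x; exists x.
have [d dg Hd] : exists2 d, good_denom d & forall r, r \in s -> exists k : int, r *+ d = k%:~R.
  by apply: IH => t ts; apply: H; rewrite inE ts orbT.
have [d' dg' [k' ek']] := H r (mem_head _ _).
exists (d * d')%N => [|t]; first exact: good_denomM.
rewrite inE => /predU1P[->|/Hd[k ek]].
  by exists (k' *+ d); rewrite mulnC mulrnA ek' rmorphMn.
by exists (k *+ d'); rewrite mulrnA ek rmorphMn.
Qed.

Lemma explicit_component (j : 'I_m) : exists d (t : term 'I_n), good_denom d /\
  forall x z, @solves phi Qlg x z -> (z j : rat) *+ d = evalQ x t.
Proof.
have rowE l (z : 'I_l -> rat) : z = (\row_i z i) 0.
  by apply/funext => i; rewrite mxE.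
have ex (x : 'rV[rat]_n) : exists z : 'rV[rat]_m, @solves phi Qlg (x 0) (z 0).
  have [z Hz] := solvesQ_ex A0phi A0nt (x 0).
  by exists (\row_i z i); rewrite -rowE.
have [f Hf] := choice ex.
have fP (x : 'rV[rat]_n) (z : 'rV[rat]_m) :
    evalQ (vpair (x 0) (z 0)) (sysT phi) <= 0 <-> z = f x.
  split=> [/solvesQ H|->]; last exact/solvesQ.
  by apply/rowP => i; rewrite (solvesQ_uniq A0phi A0nt H (Hf x)).
have [Ms HMs] := finitely_many_pieces (@sysT_ge0 phi) fP.
pose g x : rat := f x 0 j; pose cs := [seq col j M | M <- Ms].
have gline x u : cells (fun a b => exists2 c, c \in cs &
    forall t, a <= t -> t <= b -> g (x + t *: u) = cval (x + t *: u) c) 0 1.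
  have := line_pieces (@sysT_ge0 phi) fP HMs x u; apply: cellsW.
    move=> a b a' b' [M MMs H] aa' ab' bb'; exists M => // t ta tb.
    by apply: H; [apply: le_trans ta | apply: le_trans tb _].
  move=> a b _ ab _ [M MMs H]; apply: cell => //; exists (col j M); first exact: map_f.
  by move=> t ta tb; rewrite /g H // /cval colE mulmxA -colE [RHS]mxE.
have gZ D x : 0 <= D -> g (D *: x) = D * g x.
  by move=> D0; rewrite /g (fZ fP) // mxE.
have gint (y : 'rV[int]_n) : good (g (map_mx intr y)).
  exists `|denq (g (map_mx intr y))|%N.
    split=> [|A]; first by rewrite absz_gt0 denq_neq0.
    apply: (solvesQ_denom A0phi A0nt (y := y 0)).
    have := Hf (map_mx intr y); congr (solves _ _).
    by apply/funext => i; rewrite mxE.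
  exists (numq (g (map_mx intr y))).
  by rewrite pmulrn gtz0_abs ?denq_gt0 // -mulrzr -numqE.
have [Y [Yg HY]] := max_min_representation gline gZ gint goodB.
pose entries := [seq c i 0 | c : 'cV[rat]_n <- flatten Y, i <- enum 'I_n].
have [r|d dg Hd] := @common_good_denom entries.
  move=> /allpairsP[[c i] /= [/flattenP[ys ysY cys] _ ->]]; exact: Yg ysY cys.
(* [d] clears the denominators of all entries in use, so [numq] merely reads an integer off a
   rational. *)
pose F (c : 'cV[rat]_n) := tlin (fun i => numq (c i 0 *+ d)).
have FE ys c (x : 'I_n -> rat) : ys \in Y -> c \in ys ->
    evalQ x (F c) = cval (\row_i x i) c *+ d.
  move=> ysY cys; rewrite evalQ_tlin /cval mxE -sumrMnl; apply: eq_bigr => i _.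
  have [|k ek] := Hd (c i 0).
    apply/allpairsP; exists (c, i); split=> //=; last by rewrite mem_enum.
    by apply/flattenP; exists ys.
  by rewrite ek numq_int mxE -ek mulrnAr.
exists d, (tmax (fun ys => tmin F ys) Y); split=> // x z Hz.
have -> : z j = g (\row_i x i).
  rewrite /g; have := Hf (\row_i x i); rewrite -rowE.
  by move/(solvesQ_uniq A0phi A0nt Hz) ->.
have [HYle [ys ysY HYge]] := HY (\row_i x i).
have ne (ys' : seq 'cV[rat]_n) : ys' \in Y -> ys' != [::].
  by move/HYle => [c]; case: ys'.
have Y0 : Y != [::] by case: (Y) ysY.
apply/le_anti/andP; split.
  apply: le_trans (evalQ_tmax_ge x (fun ys => tmin F ys) ysY).
  apply: evalQ_tmin_ge; first exact: ne.
  by move=> c cys; rewrite (FE ys) // lerMn2r HYge ?orbT.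
apply: evalQ_tmax_le => // ys' ysY'; have [c cys le] := HYle _ ysY'.
apply: le_trans (evalQ_tmin_le x F cys) _.
by rewrite (FE ys') // lerMn2r le orbT.
Qed.

(** Over Q the system is equivalent to the equations d_j z_j = t_j(x). Both implications consist of
    quasi-identities, so the equivalence holds in every A; uniqueness of the quotients is
    torsion-freeness. *)
Theorem sat_divisible : exists2 d, (0 < d)%N & forall A, sat A phi <-> divisible A d.
Proof.
have [d Hd] := choice explicit_component.
have [t {}Hd] := choice Hd.
have pos j : (0 < d j)%N by have [[]] := Hd j.
exists (\prod_j d j)%N; first by rewrite prodn_gt0.
have sol (A : lgroupType) (x : 'I_n -> A) z : @solves phi A x z ->
    forall j, z j *+ d j = eval x (t j).
  move=> Hz j; pose ren := term_subst (fun i => TVar (inl i) : term ('I_n + 'I_m)).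
  have := @quasi_identity _ (sysT phi) (tmuln (d j) (TVar (inr j))) (ren (t j)) _ A _ Hz.
  rewrite eval_tmulnE eval_term_subst; apply=> v Hv.
  rewrite evalQ_tmuln /evalQ eval_term_subst; have [_ H] := Hd j.
  rewrite -[RHS](H (fun i => v (inl i)) (fun i => v (inr i))) //.
  apply/solvesQ; move: Hv; congr (evalQ _ _ <= _).
  by apply/funext => -[].
have sol' (A : lgroupType) (x : 'I_n -> A) (z : 'I_m -> A) :
    (forall j, z j *+ d j = eval x (t j)) -> @solves phi A x z.
  move=> Hz; pose ren := term_subst (fun i => TVar (inl i) : term ('I_n + 'I_m)).
  pose P := conjT (fun j => tmuln (d j) (TVar (inr j))) (fun j => ren (t j)).
  apply: (@quasi_identity_le _ P); last first.
    by apply/conjT_le0 => j; rewrite eval_tmulnE eval_term_subst; apply: Hz.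
  move=> v /lg_leQ/conjT_le0 Hv.
  have [z' Hz'] := solvesQ_ex A0phi A0nt (fun i => v (inl i)).
  have -> : v = vpair (fun i => v (inl i)) z'; last exact/solvesQ.
  apply/funext => -[//|j] /=; have [_ H] := Hd j.
  have := Hv j; rewrite eval_tmulnE eval_term_subst Qlg_mulrn.
  have := H _ _ Hz'; rewrite /evalQ => <- e.
  by apply/eqP; rewrite -(@eqr_pMn2r rat (d j)) //; apply/eqP.
move=> A; split=> [HA|/divisible_prod HA].
  by apply/divisible_prod => j; have [[_ H] _] := Hd j; apply: H.
apply/sat_solves => x; have /choice[z Hz] j := HA j (eval x (t j)).
exists z => [|z' /sol Hz']; first exact: sol'.
apply/funext => j; move: (Hz j) (Hz' j); rewrite -(prednK (pos j)) => <-.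
by move/lg_mulrn_inj.
Qed.

End ExplicitSolution.

(** * AE-subclasses *)

Local Open Scope classical_set_scope.

Lemma divisible_primes (A : lgroupType) d : (0 < d)%N ->
  divisible A d <-> forall p, prime p -> (p %| d)%N -> divisible A p.
Proof.
move=> d0; split=> [H p _ /dvdnP[k e]|].
  by move: H; rewrite e => /divisibleM[].
elim/ltn_ind: d d0 => d IH d0 H.
have [d1|d1] := leqP d 1.
  have -> : d = 1%N by apply/eqP; rewrite eqn_leq d1.
  by move=> x; exists x.
have [q q_prime qd] : exists2 q, prime q & (q %| d)%N.
  by exists (pdiv d); [apply: pdiv_prime | apply: pdiv_dvd].
have [k e] := dvdnP qd; have k0 : (0 < k)%N.
  by move: d0; rewrite e muln_gt0 => /andP[].
rewrite e; apply/divisibleM; split; last exact: H.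
apply: IH => // [|p p_prime pk]; last by apply: H => //; rewrite e dvdn_mulr.
by rewrite [X in (_ < X)%N]e ltn_Pmulr // prime_gt1.
Qed.

Lemma sat_delta_divisible (A : lgroupType) k : (0 < k)%N ->
  sat A (delta k) <-> divisible A k.
Proof.
move=> k0; rewrite sat_delta; split=> H x; have [z] := H x.
  by case=> <- _; exists z; rewrite lg_mulnE.
move=> <-; exists z; split=> [|z']; rewrite !lg_mulnE //.
by rewrite -(prednK k0) => /lg_mulrn_inj.
Qed.

(** * The localization of Z at a prime *)

Section LocalizedIntegers.
Variable p : nat.
Hypothesis p_prime : prime p.

Definition localized (r : rat) : bool :=
  `[< exists2 b : nat, ~~ (p %| b)%N & exists a : int, r *+ b = a%:~R >].

Lemma localizedP r : localized r <->
  exists2 b : nat, ~~ (p %| b)%N & exists a : int, r *+ b = a%:~R.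
Proof. by split=> /asboolP. Qed.

Lemma localized0 : localized 0.
Proof.
apply/localizedP; exists 1%N; last by exists 0.
by rewrite dvdn1 neq_ltn prime_gt1 ?orbT.
Qed.

Lemma localizedD r s : localized r -> localized s -> localized (r + s).
Proof.
move=> /localizedP[b pb [a ea]] /localizedP[b' pb' [a' ea']]; apply/localizedP.
exists (b * b')%N; first by rewrite Euclid_dvdM // negb_or pb.
exists (a *+ b' + a' *+ b).
by rewrite mulrnDl mulrnA ea [(b * b')%N]mulnC mulrnA ea' rmorphD !rmorphMn.
Qed.

Lemma localizedN r : localized r -> localized (- r).
Proof.
move=> /localizedP[b pb [a ea]]; apply/localizedP; exists b => //; exists (- a).
by rewrite mulNrn ea rmorphN.
Qed.

Lemma localized_max r s : localized r -> localized s -> localized (Num.max r s).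
Proof. by case: (leP r s). Qed.

Lemma localized_min r s : localized r -> localized s -> localized (Num.min r s).
Proof. by case: (leP r s). Qed.

Definition Zloc_sort : Type := {r : rat | localized r}.
Implicit Types x y z : Zloc_sort.

Definition Zloc_add x y : Zloc_sort := Sub (val x + val y) (localizedD (valP x) (valP y)).
Definition Zloc_opp x : Zloc_sort := Sub (- val x) (localizedN (valP x)).
Definition Zloc_zero : Zloc_sort := Sub 0 localized0.
Definition Zloc_max x y : Zloc_sort :=
  Sub (Num.max (val x) (val y)) (localized_max (valP x) (valP y)).
Definition Zloc_min x y : Zloc_sort :=
  Sub (Num.min (val x) (val y)) (localized_min (valP x) (valP y)).

Definition Zloc : lgroupType.
Proof.
apply: (@LGroup Zloc_sort Zloc_add Zloc_opp Zloc_zero Zloc_max Zloc_min).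
- by move=> x y z; apply: val_inj; rewrite /= addrA.
- by move=> x y; apply: val_inj; rewrite /= addrC.
- by move=> x; apply: val_inj; rewrite /= add0r.
- by move=> x; apply: val_inj; rewrite /= addNr.
- by move=> x y; apply: val_inj; rewrite /= maxC.
- by move=> x y; apply: val_inj; rewrite /= minC.
- by move=> x y z; apply: val_inj; rewrite /= maxA.
- by move=> x y z; apply: val_inj; rewrite /= minA.
- by move=> y x; apply: val_inj; apply: rat_joinKI.
- by move=> y x; apply: val_inj; apply: rat_meetKU.
- by move=> x y z; apply: val_inj; rewrite /= addr_maxr.
Defined.

Lemma val_Zloc_mulrn (x : Zloc) k : val (x *+ k : Zloc_sort) = val (x : Zloc_sort) *+ k.
Proof. by elim: k => [//|k IH]; rewrite !mulrS -IH. Qed.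

Lemma Zloc_divisible q : prime q -> q <> p -> divisible Zloc q.
Proof.
move=> q_prime qp x; have q0 : q%:R != 0 :> rat by rewrite pnatr_eq0 -lt0n prime_gt0.
have loc : localized (val (x : Zloc_sort) / q%:R).
  have /localizedP[b pb [a ea]] := valP (x : Zloc_sort); apply/localizedP.
  exists (b * q)%N; last by exists a; rewrite mulnC mulrnA -[_ / _ *+ q]mulr_natr divfK.
  rewrite Euclid_dvdM // negb_or pb dvdn_prime2 //; apply/eqP => e; exact: qp.
exists (Sub _ loc : Zloc_sort); apply: val_inj.
by rewrite [LHS]val_Zloc_mulrn /= -[LHS]mulr_natr divfK.
Qed.

Lemma Zloc_not_divisible : ~ divisible Zloc p.
Proof.
have loc1 : localized 1.
  apply/localizedP; exists 1%N; last by exists 1.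
  by rewrite dvdn1 neq_ltn prime_gt1 ?orbT.
move=> /(_ (Sub 1 loc1 : Zloc_sort))[c /(congr1 (fun y : Zloc_sort => val y))].
rewrite [LHS]val_Zloc_mulrn /= => ec.
have /localizedP[b pb [a ea]] := valP (c : Zloc_sort).
have : (b%:Z)%:~R = (a *+ p)%:~R :> rat.
  by rewrite rmorphMn /= -ea -mulrnA mulnC mulrnA ec -pmulrn.
move/intr_inj => e; move/negP: pb; apply.
by rewrite -[b]/(`|b%:Z|%N) e -mulr_natr abszM natz dvdn_mull.
Qed.

End LocalizedIntegers.

Lemma Mod_SigmaE (S : set nat) (A : lgroupType) : S `<=` prime ->
  Mod (Sigma_ S) A <-> forall p, S p -> divisible A p.
Proof.
move=> Sp; split=> [H p pS|H _ [p pS <-]].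
  by apply/sat_delta_divisible; [apply/prime_gt0/Sp | apply: H; exists p].
by apply/sat_delta_divisible; [apply/prime_gt0/Sp | apply: H].
Qed.

Lemma sat_trivial (A : lgroupType) phi : trivial_lgroup A -> sat A phi.
Proof.
move=> tA x; exists [tuple lg_zero A | _ < efd_m phi]; split=> // z _.
by apply: eq_from_tnth => i; apply: tA.
Qed.

Lemma Qlg_divisible k : (0 < k)%N -> divisible Qlg k.
Proof.
move=> k0 x; exists ((x : rat) / k%:R : rat); rewrite Qlg_mulrn -[LHS]mulr_natr divfK //.
by rewrite pnatr_eq0 -lt0n.
Qed.

Lemma Qlg_nontrivial : ~ trivial_lgroup Qlg.
Proof. by move=> /(_ (0 : rat) (1 : rat)). Qed.

(** A single nontrivial model of all of [Sigma] lets [sat_divisible] be applied to each of its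
    sentences separately. *)
Lemma Mod_classification (Sigma : set efd) :
  (forall A : lgroupType, Mod Sigma A -> trivial_lgroup A) \/
  (exists2 S : set nat, S `<=` prime & equiv_over_lgroups Sigma (Sigma_ S)).
Proof.
have [|/existsNP[A0 /not_implyP[A0S A0nt]]] :=
  pselect (forall A : lgroupType, Mod Sigma A -> trivial_lgroup A); first by left.
right; pose S := [set p | prime p /\ exists2 phi, Sigma phi &
  forall A, sat A phi -> divisible A p].
have Sp : S `<=` prime by move=> p [].
exists S => // A; rewrite Mod_SigmaE //; split=> [H p [_ [phi phiS]]|H phi phiS].
  by apply; apply: H.
have [d d0 Hd] := sat_divisible (A0S phi phiS) A0nt.
apply/Hd/divisible_primes => // p p_prime pd; apply: H; split=> //.
by exists phi => // B /Hd/divisible_primes; apply.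
Qed.

Lemma Sigma_inj (S1 S2 : set nat) : S1 `<=` prime -> S2 `<=` prime ->
  equiv_over_lgroups (Sigma_ S1) (Sigma_ S2) -> S1 = S2.
Proof.
suff sub (T1 T2 : set nat) : T1 `<=` prime -> T2 `<=` prime ->
    equiv_over_lgroups (Sigma_ T1) (Sigma_ T2) -> T1 `<=` T2.
  move=> p1 p2 e; apply/seteqP; split; apply: sub => // A; split=> /e //.
move=> p1 p2 e p pT1; apply: contrapT => pT2.
have pp : prime p by apply: p1.
apply: (@Zloc_not_divisible p pp).
apply: (iffLR (Mod_SigmaE (Zloc pp) p1)) => //; apply/e/Mod_SigmaE => // q qT2.
by apply: Zloc_divisible; [apply: p2 | move=> qp; apply: pT2; rewrite -qp].
Qed.

(** Matches sets of primes with the subsets of [nat] that represent the lattice of subsets of a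
    countable set. *)
Lemma prime_enumeration : exists pr : nat -> nat,
  [/\ forall i, prime (pr i), injective pr & forall p, prime p -> exists i, pr i = p].
Proof.
have inf : infinite_set [set p | prime p].
  move=> /finite_seqP[s es]; have [p pmax pp] := prime_above (\max_(q <- s) q).
  have : [set p | prime p] p by [].
  by rewrite es /= => ps; move: pmax; rewrite ltnNge leq_bigmax_seq.
have : ([set: nat] #= [set p | prime p])%card.
  by rewrite card_eq_le; apply/andP; split; [apply/infiniteP | apply: subset_card_le].
move=> /card_set_bijP[pr [prf prinj prsurj]]; exists pr; split=> [i|i j e|p pp].
- exact: prf.
- by apply: prinj; rewrite ?inE.
- by have [i _ e] := prsurj p pp; exists i.
Qed.

(** With no equations every z is a solution, so uniqueness leaves a single element. *)
Definition inconsistent : efd :=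
  @EFD 0 1 0 (ltn0Sn 0) (fun=> TZero) (fun=> TZero).

Lemma sat_inconsistent (A : lgroupType) : sat A inconsistent -> trivial_lgroup A.
Proof.
move=> /(_ [tuple])[z [_ uz]] a b.
have H c : z = [tuple c] by apply: uz => -[].
by have := etrans (esym (H a)) (H b) => /(congr1 (fun t => tnth t ord0)).
Qed.

(** More primes mean fewer models, so a class is sent to the indices of the primes it does not
    force: the complement turns the order around. The class of trivial l-groups goes to the added
    bottom. *)
Lemma ae_lattice_iso : lattice_iso aeSubclass (osum 'I_1 (set nat)).
Proof.
have [pr [prP pr_inj pr_surj]] := prime_enumeration.
pose triv (K : aeSubclass) := val K `<=` trivial_lgroup.
pose bad (K : aeSubclass) := [set i | ~ (val K `<=` divisible^~ (pr i))].
pose F (K : aeSubclass) : osum 'I_1 (set nat) :=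
  if pselect (triv K) then inl ord0 else inr (bad K).
have Fmono : {mono F : K L / (K <= L)%O}.
  move=> K L; rewrite /F; case: pselect => tK; case: pselect => tL.
  (* Trivial l-groups satisfy every EFD-sentence, so a class consisting of them lies below all
     others. *)
  - apply/esym; have : val K `<=` val L; last by rewrite -ae_leE => ->.
    have [Sigma _ <-] := set_mem (valP L).
    by move=> A /tK tA phi _; apply: sat_trivial.
  - apply/esym; have : val K `<=` val L; last by rewrite -ae_leE => ->.
    have [Sigma _ <-] := set_mem (valP L).
    by move=> A /tK tA phi _; apply: sat_trivial.
  - apply/esym/negbTE/negP; rewrite ae_leE => KL; apply: tK => A /KL; exact: tL.
  - rewrite -[LHS]/(bad K <= bad L)%O; apply/idP/idP; last first.
      rewrite ae_leE => KL; rewrite subsetEset => i /= nK nL; apply: nK => A /KL; exact: nL.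
    rewrite subsetEset => sub; rewrite ae_leE.
    have [Sigma _ eL] := set_mem (valP L).
    have [tS|[S Sp eS]] := Mod_classification Sigma.
      by case: tL; rewrite /triv -eL.
    rewrite -eL => A AK; apply/eS/Mod_SigmaE => // p pS.
    have [i ei] := pr_surj p (Sp p pS); subst p.
    apply: contrapT => nA; have : bad L i by apply: sub => /(_ A AK).
    by apply; rewrite -eL => B /eS/Mod_SigmaE; apply.
exists F; split=> //.
have Finj : injective F by move=> K L e; apply/le_anti; rewrite -!Fmono e lexx.
have Fsurj y : exists K, F K = y.
  case: y => [i|X].
    exists (ae_of [set inconsistent]); rewrite /F.
    case: pselect => [tK|nt]; first by rewrite (ord1 i).
    by exfalso; apply: nt => A HA; apply: sat_inconsistent; apply: HA.
  pose S := [set p | exists2 i, ~ X i & pr i = p].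
  have Sp : S `<=` prime by move=> p [i _ <-].
  have ModS A : val (ae_of (Sigma_ S)) A <-> forall p, S p -> divisible A p.
    exact: Mod_SigmaE.
  exists (ae_of (Sigma_ S)); rewrite /F; case: pselect => [tS|ntS].
    (* Q is divisible, hence a nontrivial model of every [Sigma_ S]; none of these classes goes to
       the bottom. *)
    case: Qlg_nontrivial; apply: tS; apply/ModS => p /Sp pp.
    exact/Qlg_divisible/prime_gt0.
  congr inr; apply/seteqP; split=> [i /= nK|i Xi nK].
    by apply: contrapT => Xi; apply: nK => A /ModS; apply; exists i.
  apply: (@Zloc_not_divisible (pr i) (prP i)); apply: nK.
  apply/ModS => _ [j nXj <-]; apply: Zloc_divisible => // e.
  by apply: nXj; rewrite (pr_inj _ _ e).
have [G FG] := choice Fsurj.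
by exists G => // K; apply: Finj; rewrite FG.
Qed.

Theorem theorem4p13 :
  (forall Sigma : set efd,
     (forall A : lgroupType, Mod Sigma A -> trivial_lgroup A) \/
     (exists2 S : set nat, S `<=` prime & equiv_over_lgroups Sigma (Sigma_ S)))
  /\
  (forall S1 S2 : set nat, S1 `<=` prime -> S2 `<=` prime ->
     equiv_over_lgroups (Sigma_ S1) (Sigma_ S2) -> S1 = S2)
  /\
  lattice_iso aeSubclass (osum 'I_1 (set nat)).
Proof.
split; first exact: Mod_classification.
by split; [exact: Sigma_inj | exact: ae_lattice_iso].
Qed.
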